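(* Let $P$ be a CHR program such that the abstract transition relation $\rightarrow_a$ of $P$ is confluent. Let $\langle D; E; \bar X\rangle$ be a CHR state having at least one answer, i.e. there is an answer $\sigma'\in\Sigma_b$ with $\langle D; E; \bar X\rangle \rightarrow_a^* \sigma'$. Then \[ \langle D; E; \bar X\rangle \in \mathcal{M}^{\mu}(P) \quad\text{if and only if}\quad \exists\,(D\wedge E)\ \text{is satisfiable within } \mathcal{CP}. \]
   Context: Built-in constraints are formulas of a constraint language containing $=$, $\mathit{true}$, $\mathit{false}$, interpreted in a first-order theory $CT$ whose non-logical axioms are coherent formulas $\forall(C\rightarrow \exists\bar Z.D)$ with $C,D$ possibly empty conjunctions of built-in constraints. User-defined (CHR) constraints are atoms built from a disjoint set of predicate symbols. Multisets of constraints are identified with conjunctions; $\mathrm{fv}(\phi)$ is the set of free variables of $\phi$; $\exists_{-\bar X}\phi$ is the existential closure of $\phi$ except for the variables $\bar X$. A CHR program is a finite set of rules $r @ K\backslash H \Longleftrightarrow G \mid C, B$ where $K$ (kept head) and $H$ (removed head) are multisets of CHR constraints, not both empty, $G$ (guard) and $C$ are conjunctions of built-in constraints, $B$ is a multiset of CHR constraints, and $r$ is a unique name; its local variables are $\mathrm{lv}(r)=\mathrm{fv}(G,C,B)\setminus\mathrm{fv}(K,H)$. The rule is a simplification rule if $H\neq\emptyset$ and a propagation rule otherwise. A state is a triple $\langle S; E; \bar X\rangle$ with $S$ a multiset of CHR constraints, $E$ a conjunction of built-in constraints and $\bar X$ a set of variables; $\Sigma$ is the set of states and $\Sigma_b$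 the set of answers (states with $S=\emptyset$). A state is consistent if its built-in store is satisfiable in $CT$. The logical reading of a rule is $\forall((K\wedge G)\rightarrow(H\leftrightarrow \exists_{-\mathrm{fv}(K,H)}(G\wedge C\wedge B)))$, of a state is $\exists_{-\bar X}(S\wedge E)$; $\mathcal{CP}$ is $CT$ together with the logical readings of the rules of $P$. The abstract equivalence $\equiv_a$ is the least equivalence on $\Sigma$ such that: (1) $\langle S; Y=t\wedge D; \bar X\rangle\equiv_a\langle S[Y\backslash t]; Y=t\wedge D;\bar X\rangle$; (2) $\langle S; \mathit{false};\bar X\rangle\equiv_a\langle S';\mathit{false};\bar X\rangle$; (3) $\langle S; D;\bar X\rangle\equiv_a\langle S;E;\bar X\rangle$ if $CT\models \exists_{-\mathrm{fv}(S,\bar X)}D\leftrightarrow\exists_{-\mathrm{fv}(S,\bar X)}E$; (4) $\langle S;E;\bar X\rangle\equiv_a\langle S;E;\{Y\}\cup\bar X\rangle$ if $Y\notin\mathrm{fv}(S,E)$. For a sound equivalence $\equiv_i$ (equivalent states have logically equivalent readings in $CT$), the transition relation $\rightarrow_i$ of $P$ is the least relation such that $\langle K,H,D; G\wedge E;\bar X\rangle\rightarrow_i\langle B,K,D; C\wedge G\wedge E;\bar X\rangle$ whenever $(r @ K\backslash H\Longleftrightarrow G\mid C,B)$ is a renamed variant of a rule of $P$ with $\mathrm{lv}(r)\cap\bar X=\emptyset$, and such that $\sigma_1\equiv_i\sigma_1'\rightarrow_i\sigma_2'\equiv_i\sigma_2$ implies $\sigma_1\rightarrow_i\sigma_2$.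 $\rightarrow_i^*$ is the transitive closure of $\rightarrow_i\cup\equiv_i$. $\rightarrow_i$ is confluent if $\sigma\rightarrow_i^*\sigma_1$ and $\sigma\rightarrow_i^*\sigma_2$ imply the existence of $\sigma'$ with $\sigma_1\rightarrow_i^*\sigma'$ and $\sigma_2\rightarrow_i^*\sigma'$. $[\![\sigma]\!]_i$ is the $\equiv_i$-class of $\sigma$; $\bot$ denotes the failed state $\langle\emptyset;\mathit{false};\emptyset\rangle$. The existential immediate cause operator is $\langle P\rangle_i(\mathcal X)=\{\sigma\in\Sigma\mid \exists\sigma'\in\mathcal X,\ \sigma\rightarrow_i\sigma'\}$, and the inductive semantics is $\mathcal M^{\mu}(P)=\mu\mathcal X.\big(\langle P\rangle_a(\mathcal X)\cup(\Sigma_b\setminus[\![\bot]\!]_a)\big)$ (least fixpoint over subsets of $\Sigma$).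
   Formalization: In a transition, the local variables of the renamed rule must avoid not only X̄ but also the remaining constraints D and E; with X̄ alone the claim fails, e.g. for p(A)⇔p(A),r(A,C) and r(A,A)⇔false. *)

(* Defs.v *)
(* In MathComp, with finmap and mathcomp-classical: [set x | P] is a classical
   set, finite sets of variables are of type {fset _}. *)
From Stdlib Require Export Relations Permutation.
From mathcomp Require Export all_boot finmap.
From mathcomp Require Export boolp classical_sets.

Set Implicit Arguments.
Unset Strict Implicit.
Unset Printing Implicit Defensive.

Local Open Scope fset_scope.
Local Open Scope classical_set_scope.

(* Function symbols, built-in predicate symbols and CHR predicate symbols, each
   with its arity; the two kinds of predicate symbols are disjoint. *)
Record signature := Signature {
  fsym : Type; farity : fsym -> nat;
  bsym : Type; barity : bsym -> nat;
  csym : Type; carity : csym -> nat }.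

Arguments farity {_}.
Arguments barity {_}.
Arguments carity {_}.

Definition var := nat.

Record renaming := Renaming { ren :> var -> var; ren_bij : bijective ren }.

Section Syntax.
Variable Sg : signature.

Inductive term :=
| Var of var
| App (f : fsym Sg) of ('I_(farity f) -> term).

Inductive atom := Atom (p : csym Sg) of ('I_(carity p) -> term).

Inductive formula :=
| FTrue
| FFalse
| FEq of term & term
| FPred (p : bsym Sg) of ('I_(barity p) -> term)
| FChr of atom
| FAnd of formula & formula
| FOr of formula & formula
| FImp of formula & formula
| FAll of var & formula
| FEx of var & formula.

Definition FIff (A B : formula) := FAnd (FImp A B) (FImp B A).

Definition conj (As : seq formula) : formula := foldr FAnd FTrue As.

Fixpoint tfv (t : term) : {fset var} :=
  match t with
  | Var x => [fset x]
  | App f ts => \big[fsetU/fset0]_(i < farity f) tfv (ts i)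
  end.

Definition afv (a : atom) : {fset var} :=
  let: Atom p ts := a in \big[fsetU/fset0]_(i < carity p) tfv (ts i).

Fixpoint ffv (A : formula) : {fset var} :=
  match A with
  | FTrue | FFalse => fset0
  | FEq t u => tfv t `|` tfv u
  | FPred p ts => \big[fsetU/fset0]_(i < barity p) tfv (ts i)
  | FChr a => afv a
  | FAnd A1 A2 | FOr A1 A2 | FImp A1 A2 => ffv A1 `|` ffv A2
  | FAll x A1 | FEx x A1 => ffv A1 `\ x
  end%fset.

Definition goal_fv (S : seq atom) : {fset var} :=
  \big[fsetU/fset0]_(a <- S) afv a.

Fixpoint tsubst (s : var -> term) (t : term) : term :=
  match t with
  | Var x => s x
  | App f ts => App (fun i => tsubst s (ts i))
  end.

Definition asubst (s : var -> term) (a : atom) : atom :=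
  let: Atom p ts := a in Atom (fun i => tsubst s (ts i)).

Definition subst1 (Y : var) (t : term) : var -> term :=
  fun x => if x == Y then t else Var x.

Definition trename (r : renaming) : term -> term := tsubst (fun x => Var (r x)).

Definition arename (r : renaming) : atom -> atom := asubst (fun x => Var (r x)).

(* A renaming permutes all variables, so it can act on binders too without
   capture. *)
Fixpoint frename (r : renaming) (A : formula) : formula :=
  match A with
  | FTrue => FTrue
  | FFalse => FFalse
  | FEq t u => FEq (trename r t) (trename r u)
  | FPred p ts => FPred (fun i => trename r (ts i))
  | FChr a => FChr (arename r a)
  | FAnd A1 A2 => FAnd (frename r A1) (frename r A2)
  | FOr A1 A2 => FOr (frename r A1) (frename r A2)
  | FImp A1 A2 => FImp (frename r A1) (frename r A2)
  | FAll x A1 => FAll (r x) (frename r A1)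
  | FEx x A1 => FEx (r x) (frename r A1)
  end.

Fixpoint builtin (A : formula) : Prop :=
  match A with
  | FTrue | FFalse | FEq _ _ | FPred _ _ => True
  | FChr _ => False
  | FAnd A1 A2 | FOr A1 A2 | FImp A1 A2 => builtin A1 /\ builtin A2
  | FAll _ A1 | FEx _ A1 => builtin A1
  end.

Definition ex_vars (Z : seq var) (A : formula) : formula := foldr FEx A Z.

Definition all_closure (A : formula) : formula :=
  foldr FAll A (enum_fset (ffv A)).

Definition ex_except (X : {fset var}) (A : formula) : formula :=
  ex_vars (enum_fset (ffv A `\` X)%fset) A.

Definition ex_closure (A : formula) : formula := ex_except fset0 A.

(* Structures interpret the whole signature.  For a theory over the built-in
   symbols only, the interpretation of the CHR symbols is irrelevant. *)
Record structure := Structure {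
  dom : Type;
  dom_inh : inhabited dom;
  fint : forall f : fsym Sg, ('I_(farity f) -> dom) -> dom;
  bint : forall p : bsym Sg, ('I_(barity p) -> dom) -> Prop;
  cint : forall p : csym Sg, ('I_(carity p) -> dom) -> Prop }.

Fixpoint teval (M : structure) (v : var -> dom M) (t : term) : dom M :=
  match t with
  | Var x => v x
  | App f ts => fint (fun i => teval v (ts i))
  end.

Definition update (T : Type) (v : var -> T) (x : var) (d : T) : var -> T :=
  fun y => if y == x then d else v y.

Fixpoint sat (M : structure) (v : var -> dom M) (A : formula) : Prop :=
  match A with
  | FTrue => True
  | FFalse => False
  | FEq t u => teval v t = teval v u
  | FPred p ts => bint (fun i => teval v (ts i))
  | FChr (Atom p ts) => cint (fun i => teval v (ts i))
  | FAnd A1 A2 => sat v A1 /\ sat v A2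
  | FOr A1 A2 => sat v A1 \/ sat v A2
  | FImp A1 A2 => sat v A1 -> sat v A2
  | FAll x A1 => forall d : dom M, sat (update v x d) A1
  | FEx x A1 => exists d : dom M, sat (update v x d) A1
  end.

Definition model (T : set formula) (M : structure) : Prop :=
  forall A, T A -> forall v : var -> dom M, sat v A.

Definition entails (T : set formula) (A : formula) : Prop :=
  forall M, model T M -> forall v : var -> dom M, sat v A.

Definition satisfiable (T : set formula) (A : formula) : Prop :=
  exists M, model T M /\ exists v : var -> dom M, sat v A.

(* The built-in constraints need not be atomic: any set of CHR-free formulas
   that contains =, true and false and is closed under renaming will do. *)
Record constraint_language := ConstraintLanguage {
  lang :> formula -> Prop;
  lang_builtin : forall A, lang A -> builtin A;
  lang_true : lang FTrue;
  lang_false : lang FFalse;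
  lang_eq : forall t u, lang (FEq t u);
  lang_rename : forall (r : renaming) A, lang A -> lang (frename r A) }.

End Syntax.

Arguments Var {Sg}.
Arguments FTrue {Sg}.
Arguments FFalse {Sg}.

Section CHR.
Variables (Sg : signature) (L : constraint_language Sg).

Definition constraint := {A : formula Sg | L A}.

Definition cfalse : constraint := exist _ FFalse (lang_false L).

Definition ceq (t u : term Sg) : constraint := exist _ (FEq t u) (lang_eq L t u).

Definition crename (r : renaming) (c : constraint) : constraint :=
  exist _ (frename r (sval c)) (lang_rename r (svalP c)).

Definition bconj (E : seq constraint) : formula Sg := conj (map sval E).

Definition gconj (S : seq (atom Sg)) : formula Sg := conj (map (@FChr Sg) S).

Definition coherent (A : formula Sg) : Prop :=
  exists (C D : seq constraint) (Z : seq var),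
    A = all_closure (FImp (bconj C) (ex_vars Z (bconj D))).

Record rule := Rule {
  kept : seq (atom Sg);
  removed : seq (atom Sg);
  guard : seq constraint;
  body_builtin : seq constraint;
  body_chr : seq (atom Sg) }.

Definition head_fv (r : rule) : {fset var} :=
  (goal_fv (kept r) `|` goal_fv (removed r))%fset.

Definition local_vars (r : rule) : {fset var} :=
  ((ffv (bconj (guard r)) `|` ffv (bconj (body_builtin r))
    `|` goal_fv (body_chr r)) `\` head_fv r)%fset.

Definition rule_rename (rho : renaming) (r : rule) : rule :=
  Rule (map (arename rho) (kept r)) (map (arename rho) (removed r))
       (map (crename rho) (guard r)) (map (crename rho) (body_builtin r))
       (map (arename rho) (body_chr r)).

(* The position of a rule in the list plays the part of its unique name. *)
Record program := Program {
  rules :> seq rule;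
  rules_head : forall r, List.In r rules -> kept r ++ removed r <> [::] }.

Definition variant (P : program) (r : rule) : Prop :=
  exists (r0 : rule) (rho : renaming), List.In r0 P /\ r = rule_rename rho r0.

Definition rule_reading (r : rule) : formula Sg :=
  all_closure
    (FImp (FAnd (gconj (kept r)) (bconj (guard r)))
          (FIff (gconj (removed r))
                (ex_except (head_fv r)
                   (FAnd (bconj (guard r))
                         (FAnd (bconj (body_builtin r))
                               (gconj (body_chr r))))))).

Definition program_theory (CT : set (formula Sg)) (P : program) :
    set (formula Sg) :=
  CT `|` [set A | exists r, List.In r P /\ A = rule_reading r].

(* The multiset of CHR constraints is represented by a list, to be read up to
   permutation: see ae_perm. *)
Record state := State {
  goal : seq (atom Sg);
  store : seq constraint;
  globals : {fset var} }.

Definition answers : set state := [set s | goal s = [::]].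

Definition failed : state := State [::] [:: cfalse] fset0.

Inductive astep (CT : set (formula Sg)) : relation state :=
| ae_perm S S' E X :
    Permutation S S' ->
    astep CT (State S E X) (State S' E X)
| ae_subst S Y t D X :
    astep CT (State S (ceq (Var Y) t :: D) X)
             (State (map (asubst (subst1 Y t)) S) (ceq (Var Y) t :: D) X)
| ae_false S S' X :
    astep CT (State S [:: cfalse] X) (State S' [:: cfalse] X)
| ae_store S D E X :
    entails CT (FIff (ex_except (goal_fv S `|` X)%fset (bconj D))
                     (ex_except (goal_fv S `|` X)%fset (bconj E))) ->
    astep CT (State S D X) (State S E X)
| ae_global S E X Y :
    Y \notin (goal_fv S `|` ffv (bconj E))%fset ->
    astep CT (State S E X) (State S E (Y |` X)%fset).

Definition aequiv (CT : set (formula Sg)) : relation state :=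
  clos_refl_sym_trans state (astep CT).

(* Variants are renamed apart: the local variables of the variant avoid not only
   the global variables X but also the untouched part D, E of the state.  With
   X alone, a local variable could be captured by E; for instance the rules
   p(A) <=> p(A), r(A,C) and r(A,A) <=> false would be confluent and would fail
   from every state that contains p, although their logical reading is
   consistent with p. *)
Inductive trans (eqv : relation state) (P : program) : relation state :=
| trans_rule r D E X :
    variant P r ->
    [disjoint local_vars r & X]%fset ->
    [disjoint local_vars r & goal_fv D `|` ffv (bconj E)]%fset ->
    trans eqv P
      (State (kept r ++ removed r ++ D) (guard r ++ E) X)
      (State (body_chr r ++ kept r ++ D) (body_builtin r ++ guard r ++ E) X)
| trans_equiv s1 s1' s2' s2 :
    eqv s1 s1' -> trans eqv P s1' s2' -> eqv s2' s2 -> trans eqv P s1 s2.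

Definition steps (eqv : relation state) (P : program) : relation state :=
  clos_trans state (fun s s' => trans eqv P s s' \/ eqv s s').

Definition confluent (eqv : relation state) (P : program) : Prop :=
  forall s s1 s2, steps eqv P s s1 -> steps eqv P s s2 ->
    exists s', steps eqv P s1 s' /\ steps eqv P s2 s'.

Definition ex_cause (eqv : relation state) (P : program) (A : set state) :
    set state :=
  [set s | exists2 s', A s' & trans eqv P s s'].

End CHR.

Arguments answers {Sg} L _.

Definition lfp (T : Type) (F : set T -> set T) : set T :=
  [set x | forall A : set T, F A `<=` A -> A x].

Lemma lfp_least (T : Type) (F : set T -> set T) (A : set T) :
  F A = A -> lfp F `<=` A.
Proof. by move=> FA x; apply; rewrite FA. Qed.

Lemma lfp_fixpoint (T : Type) (F : set T -> set T) :
  (forall A B, A `<=` B -> F A `<=` F B) -> F (lfp F) = lfp F.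
Proof.
move=> Fmono.
have pre : F (lfp F) `<=` lfp F.
  by move=> x Fx A FA; apply: (FA); apply: (Fmono _ _ _ _ Fx) => y; apply.
by apply/seteqP; split=> // x; apply; apply: Fmono.
Qed.

Definition inductive_semantics (Sg : signature) (L : constraint_language Sg)
    (CT : set (formula Sg)) (P : program L) : set (state L) :=
  lfp (fun A => ex_cause (aequiv CT) P A
                `|` (answers L `\` [set s | aequiv CT s (failed L)])).

Lemma inductive_semantics_fixpoint (Sg : signature) (L : constraint_language Sg)
    (CT : set (formula Sg)) (P : program L) :
  ex_cause (aequiv CT) P (inductive_semantics CT P)
    `|` (answers L `\` [set s | aequiv CT s (failed L)])
  = inductive_semantics CT P.
Proof.
apply: lfp_fixpoint => A B AB s [[s' As' ss']|]; last by right.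
by left; exists s' => //; apply: AB.
Qed.

(* Main.v *)
(* The store of a non-failed answer reached from the state holds in some model M
   of CT.  Call a multiset of atoms over M successful when it rewrites to the
   empty multiset by ground instances of the rules, the values of the local
   variables being chosen freely, and expand M by making true exactly the atoms
   that belong to a successful multiset.  Success goes back along every
   transition; by confluence it also goes forward (with a new choice of the
   locals), and these two facts are the two directions of the equivalence in the
   reading of a rule.  So the expansion is a model of CP, and it satisfies D and
   E.  Conversely transitions are sound in CP, so the answer of a satisfiable
   state is not failed. *)
Require Import Defs.

Set Implicit Arguments.
Unset Strict Implicit.
Unset Printing Implicit Defensive.

Local Open Scope fset_scope.

(** The forward direction has to reconcile two levels. Confluence relates symbolic states over all
    models of [CT], while a ground success lives in one model [M], where values may coincide
    although [CT] proves no equation between their terms. A ground step is therefore lifted by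
    adding to the store equations that are true in [M]. Confluence then wants the given derivation
    and the lifted step to leave from the same strengthened state, so the given derivation has to be
    replayed there. Its local variables may clash with variables of that state, which is why the
    replay is a simulation up to renaming. Truth is membership in a successful multiset, not success
    of the atom alone, because a rule with several heads needs partners. Unions of successful
    multisets are successful, so atoms that are true separately also lie together in one successful
    multiset; this makes truth of a conjunction a statement about one multiset. *)

Definition agree (T : Type) (X : {fset var}) (v w : var -> T) : Prop :=
  forall x, x \in X -> v x = w x.

Lemma agree_sub (T : Type) (X Y : {fset var}) (v w : var -> T) :
  (forall x, x \in X -> x \in Y) -> agree Y v w -> agree X v w.
Proof. by move=> XY vw x /XY/vw. Qed.

Lemma agree_sym (T : Type) (X : {fset var}) (v w : var -> T) :
  agree X v w -> agree X w v.
Proof. by move=> vw x /vw. Qed.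

Lemma agreeU (T : Type) (X Y : {fset var}) (v w : var -> T) :
  agree (X `|` Y) v w <-> agree X v w /\ agree Y v w.
Proof.
split=> [vw|[vX vY] x /fsetUP[/vX|/vY] //].
by split=> x xXY; apply: vw; rewrite inE xXY ?orbT.
Qed.

Lemma update_id (T : Type) (v : var -> T) (x : var) (d : T) :
  update v x d x = d.
Proof. by rewrite /update eqxx. Qed.

Lemma agree_update (T : Type) (X : {fset var}) (v : var -> T) (Y : var) (d : T) :
  Y \notin X -> agree X (update v Y d) v.
Proof.
move=> YX x xX; rewrite /update; case: eqP => // xY.
by rewrite -xY xX in YX.
Qed.

Lemma fset_bound (V : {fset var}) : exists N, forall x, x \in V -> (x < N)%N.
Proof.
exists (\max_(x <- enum_fset V) x.+1)%N => x xV.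
by rewrite (big_rem x) //= leq_maxl.
Qed.

Lemma fresh_var (V : {fset var}) : exists z, z \notin V.
Proof.
have [N NV] := fset_bound V; exists N.
by apply/negP => /NV; rewrite ltnn.
Qed.

Lemma tfv_App (Sg : signature) (f : fsym Sg) (ts : 'I_(farity f) -> term Sg) x :
  x \in tfv (App ts) <-> exists i, x \in tfv (ts i).
Proof.
split=> [/bigfcupP[i _ xi]|[i xi]]; first by exists i.
by apply/bigfcupP; exists i => //; rewrite mem_index_enum.
Qed.

Lemma afv_Atom (Sg : signature) (p : csym Sg) (ts : 'I_(carity p) -> term Sg) x :
  x \in afv (Atom ts) <-> exists i, x \in tfv (ts i).
Proof.
split=> [/bigfcupP[i _ xi]|[i xi]]; first by exists i.
by apply/bigfcupP; exists i => //; rewrite mem_index_enum.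
Qed.

Lemma ffv_FPred (Sg : signature) (p : bsym Sg) (ts : 'I_(barity p) -> term Sg) x :
  x \in ffv (FPred ts) <-> exists i, x \in tfv (ts i).
Proof.
split=> [/bigfcupP[i _ xi]|[i xi]]; first by exists i.
by apply/bigfcupP; exists i => //; rewrite mem_index_enum.
Qed.

(** * Semantics of formulas, substitutions and renamings *)

Section Logic.
Variable Sg : signature.
Implicit Types (t : term Sg) (a : atom Sg) (A : formula Sg) (S : seq (atom Sg)).
Implicit Types (M : structure Sg) (rho : renaming).

Lemma goal_fv_cons a S : goal_fv (a :: S) = afv a `|` goal_fv S.
Proof. by rewrite /goal_fv big_cons. Qed.

Lemma goal_fv_cat S S' : goal_fv (S ++ S') = goal_fv S `|` goal_fv S'.
Proof. by rewrite /goal_fv big_cat. Qed.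

Lemma goal_fv_perm S S' : Permutation S S' -> goal_fv S = goal_fv S'.
Proof.
elim=> //= [a l l' _ IH|a b l|l l' l'' _ -> _ //].
  by rewrite !goal_fv_cons IH.
by rewrite !goal_fv_cons !fsetUA [afv b `|` _]fsetUC.
Qed.

(** The arguments are domain elements and not terms, so two atoms with the same values are
    identified even when [CT] does not entail that they are equal. *)
Definition gatom M := {p : csym Sg & 'I_(carity p) -> dom M}.

Definition aeval M (v : var -> dom M) a : gatom M :=
  let: Atom p ts := a in existT _ p (fun i => teval v (ts i)).

Lemma sat_FChr M (v : var -> dom M) a :
  sat v (FChr a) = cint (projT2 (aeval v a)).
Proof. by case: a. Qed.

Lemma teval_agree M (v w : var -> dom M) t :
  agree (tfv t) v w -> teval v t = teval w t.
Proof.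
elim: t => [x|f ts IH] /= vw; first by apply: vw; rewrite inE.
congr fint; apply: functional_extensionality_dep => i; apply: IH => x xi.
by apply: vw; apply/tfv_App; exists i.
Qed.

Lemma aeval_agree M (v w : var -> dom M) a :
  agree (afv a) v w -> aeval v a = aeval w a.
Proof.
case: a => p ts /= vw; congr existT; apply: functional_extensionality_dep => i.
by apply: teval_agree => x xi; apply: vw; apply/afv_Atom; exists i.
Qed.

Lemma geval_agree M (v w : var -> dom M) S :
  agree (goal_fv S) v w -> map (aeval v) S = map (aeval w) S.
Proof.
elim: S => //= a S IH; rewrite goal_fv_cons => /agreeU[va vS].
by rewrite IH // (aeval_agree va).
Qed.

Lemma sat_agree M (v w : var -> dom M) A :
  agree (ffv A) v w -> sat v A <-> sat w A.
Proof.
elim: A v w => //=.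
- by move=> t u v w /agreeU[vt vu]; rewrite (teval_agree vt) (teval_agree vu).
- move=> p ts v w vw.
  suff -> : (fun i => teval v (ts i)) = (fun i => teval w (ts i)) by [].
  apply: functional_extensionality_dep => i; apply: teval_agree => x xi.
  by apply: vw; apply/ffv_FPred; exists i.
- by move=> a v w /aeval_agree va; have := sat_FChr v a; have := sat_FChr w a;
    rewrite /= va => -> ->.
- by move=> A IHA B IHB v w /agreeU[/IHA vA /IHB vB]; tauto.
- by move=> A IHA B IHB v w /agreeU[/IHA vA /IHB vB]; tauto.
- by move=> A IHA B IHB v w /agreeU[/IHA vA /IHB vB]; tauto.
- move=> x A IH v w vw; have {}IH d : sat (update v x d) A <-> sat (update w x d) A.
    apply: IH => y yA; rewrite /update; case: eqP => // /eqP yx.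
    by apply: vw; rewrite !inE yx.
  by split=> sA d; apply/IH.
- move=> x A IH v w vw; have {}IH d : sat (update v x d) A <-> sat (update w x d) A.
    apply: IH => y yA; rewrite /update; case: eqP => // /eqP yx.
    by apply: vw; rewrite !inE yx.
  by split=> -[d sA]; exists d; apply/IH.
Qed.

Lemma sat_all_closure M A : (forall v : var -> dom M, sat v A) ->
  forall v : var -> dom M, sat v (all_closure A).
Proof. by rewrite /all_closure => sA; elim: (enum_fset _) => //= x Z IH v d. Qed.

Lemma sat_ex_vars M (v : var -> dom M) (Z : seq var) A :
  sat v (ex_vars Z A) <->
  exists v', (forall x, x \notin Z -> v' x = v x) /\ sat v' A.
Proof.
elim: Z v => [|z Z IH] v /=.
  split=> [sA|[v' [v'v]]]; first by exists v.
  by rewrite (_ : v' = v) //; apply: functional_extensionality_dep => x; apply: v'v.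
split=> [[d /IH[v' [v'v sA]]]|[v' [v'v sA]]].
  exists v'; split=> // x; rewrite inE negb_or => /andP[xz xZ].
  by rewrite v'v // /update (negPf xz).
exists (v' z); apply/IH; exists v'; split=> // x xZ.
rewrite /update; case: eqP => [-> //|/eqP xz].
by rewrite v'v // inE negb_or xz.
Qed.

Lemma sat_ex_except M (v : var -> dom M) (X : {fset var}) A :
  sat v (ex_except X A) <-> exists v', agree X v' v /\ sat v' A.
Proof.
split=> [/sat_ex_vars[v' [v'v sA]]|[v' [v'v sA]]].
  by exists v'; split=> // x xX; apply: v'v; rewrite inE xX.
(* The prefix binds only variables of [A], but [v'] may also differ from [v] at other variables
   outside [X]; there the values of [v] are restored. *)
apply/sat_ex_vars; exists (fun x => if x \in ffv A then v' x else v x); split.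
  move=> x; rewrite inE negb_and negbK => /orP[/v'v ->|/negPf -> //].
  by case: ifP.
by apply: (proj1 (sat_agree _)) sA => x ->.
Qed.

Lemma sat_ex_closure M (v : var -> dom M) A :
  sat v (ex_closure A) <-> exists v' : var -> dom M, sat v' A.
Proof.
rewrite /ex_closure; split=> [/sat_ex_except[v' [_ sA]]|[v' sA]]; first by exists v'.
by apply/sat_ex_except; exists v'; split=> // x; rewrite inE.
Qed.

Lemma sat_conj M (v : var -> dom M) (As Bs : seq (formula Sg)) :
  sat v (conj (As ++ Bs)) <-> sat v (conj As) /\ sat v (conj Bs).
Proof. by elim: As => [|A As IH] /=; tauto. Qed.

Lemma teval_subst M (v : var -> dom M) (s : var -> term Sg) t :
  teval v (tsubst s t) = teval (fun x => teval v (s x)) t.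
Proof.
elim: t => //= f ts IH; congr fint.
by apply: functional_extensionality_dep => i; apply: IH.
Qed.

Lemma aeval_subst M (v : var -> dom M) (s : var -> term Sg) a :
  aeval v (asubst s a) = aeval (fun x => teval v (s x)) a.
Proof.
case: a => p ts /=; congr existT; apply: functional_extensionality_dep => i.
by rewrite teval_subst.
Qed.

Lemma geval_subst1 M (v : var -> dom M) (Y : var) t S :
  v Y = teval v t -> map (aeval v) (map (asubst (subst1 Y t)) S) = map (aeval v) S.
Proof.
move=> Yt; rewrite -map_comp; apply: eq_map => a /=.
rewrite aeval_subst; congr aeval; apply: functional_extensionality_dep => x.
by rewrite /subst1; case: eqP => // ->.
Qed.

Lemma aeval_rename M (v : var -> dom M) rho a :
  aeval v (arename rho a) = aeval (v \o rho) a.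
Proof. exact: aeval_subst. Qed.

Lemma geval_rename M (v : var -> dom M) rho S :
  map (aeval v) (map (arename rho) S) = map (aeval (v \o rho)) S.
Proof.
by rewrite -map_comp; apply: eq_map => a; apply: aeval_rename.
Qed.

Lemma ren_inj rho : injective rho.
Proof. exact: bij_inj (ren_bij rho). Qed.

Lemma sat_rename M (v : var -> dom M) rho A :
  sat v (frename rho A) <-> sat (v \o rho) A.
Proof.
have upd v' x d : update v' (rho x) d \o rho = update (v' \o rho) x d :> (_ -> dom M).
  apply: functional_extensionality_dep => y.
  by rewrite /update /= (inj_eq (@ren_inj rho)).
elim: A v => //=.
- by move=> t u v; rewrite /trename !teval_subst.
- move=> p ts v.
  suff -> : (fun i => teval v (trename rho (ts i))) = (fun i => teval (v \o rho) (ts i)) by [].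
  by apply: functional_extensionality_dep => i; rewrite /trename teval_subst.
- by move=> a v; have := sat_FChr v (arename rho a); have := sat_FChr (v \o rho) a;
    rewrite /= aeval_rename => -> ->.
- by move=> A IHA B IHB v; rewrite IHA IHB.
- by move=> A IHA B IHB v; rewrite IHA IHB.
- by move=> A IHA B IHB v; rewrite IHA IHB.
- move=> x A IH v; have {}IH d : sat (update v (rho x) d) (frename rho A) <->
    sat (update (v \o rho) x d) A by rewrite IH upd.
  by split=> sA d; apply/IH.
- move=> x A IH v; have {}IH d : sat (update v (rho x) d) (frename rho A) <->
    sat (update (v \o rho) x d) A by rewrite IH upd.
  by split=> -[d sA]; exists d; apply/IH.
Qed.

Lemma tfv_rename rho t x : (rho x \in tfv (trename rho t)) = (x \in tfv t).
Proof.
elim: t => [y|f ts IH]; first by rewrite !inE (inj_eq (@ren_inj rho)).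
by apply/idP/idP => /tfv_App[i xi]; apply/tfv_App; exists i; move: xi; rewrite IH.
Qed.

Lemma afv_rename rho a x : (rho x \in afv (arename rho a)) = (x \in afv a).
Proof.
case: a => p ts.
by apply/idP/idP => /afv_Atom[i xi]; apply/afv_Atom; exists i; move: xi;
  rewrite [tsubst _ _](_ : _ = trename rho (ts i)) ?tfv_rename.
Qed.

Lemma goal_fv_rename rho S x :
  (rho x \in goal_fv (map (arename rho) S)) = (x \in goal_fv S).
Proof.
elim: S => [|a S IH] /=; first by rewrite /goal_fv !big_nil !inE.
by rewrite !goal_fv_cons !inE IH afv_rename.
Qed.

Lemma ffv_rename rho A x : (rho x \in ffv (frename rho A)) = (x \in ffv A).
Proof.
elim: A => //=.
- by move=> t u; rewrite !inE !tfv_rename.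
- move=> p ts; apply/idP/idP => /ffv_FPred[i xi]; apply/ffv_FPred; exists i;
  by move: xi; rewrite tfv_rename.
- by move=> a; rewrite afv_rename.
- by move=> A IHA B IHB; rewrite !inE IHA IHB.
- by move=> A IHA B IHB; rewrite !inE IHA IHB.
- by move=> A IHA B IHB; rewrite !inE IHA IHB.
- by move=> y A IH; rewrite !inE IH (inj_eq (@ren_inj rho)).
- by move=> y A IH; rewrite !inE IH (inj_eq (@ren_inj rho)).
Qed.

Lemma tsubst_agree (s s' : var -> term Sg) t :
  agree (tfv t) s s' -> tsubst s t = tsubst s' t.
Proof.
elim: t => [x|f ts IH] /= ss'; first by apply: ss'; rewrite inE.
congr App; apply: functional_extensionality_dep => i; apply: IH => x xi.
by apply: ss'; apply/tfv_App; exists i.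
Qed.

Lemma asubst_agree (s s' : var -> term Sg) a :
  agree (afv a) s s' -> asubst s a = asubst s' a.
Proof.
case: a => p ts ss' /=; congr Atom; apply: functional_extensionality_dep => i.
by apply: tsubst_agree => x xi; apply: ss'; apply/afv_Atom; exists i.
Qed.

Lemma gsubst_agree (s s' : var -> term Sg) S :
  agree (goal_fv S) s s' -> map (asubst s) S = map (asubst s') S.
Proof.
elim: S => //= a S IH; rewrite goal_fv_cons => /agreeU[sa sS].
by rewrite IH // (asubst_agree sa).
Qed.

Lemma grename_agree rho rho' S :
  agree (goal_fv S) rho rho' -> map (arename rho) S = map (arename rho') S.
Proof. by move=> rr; apply: gsubst_agree => x xS; rewrite rr. Qed.

Lemma tsubst_Var t : tsubst Var t = t.
Proof.
elim: t => //= f ts IH; congr App; apply: functional_extensionality_dep => i.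
exact: IH.
Qed.

Lemma asubst_Var a : asubst Var a = a.
Proof.
case: a => p ts /=; congr Atom; apply: functional_extensionality_dep => i.
exact: tsubst_Var.
Qed.

Lemma gsubst_Var S : map (asubst Var) S = S.
Proof. by elim: S => //= a S ->; rewrite asubst_Var. Qed.

Lemma tsubst_comp (s s' : var -> term Sg) t :
  tsubst s (tsubst s' t) = tsubst (fun x => tsubst s (s' x)) t.
Proof.
elim: t => //= f ts IH; congr App; apply: functional_extensionality_dep => i.
exact: IH.
Qed.

Lemma asubst_comp (s s' : var -> term Sg) a :
  asubst s (asubst s' a) = asubst (fun x => tsubst s (s' x)) a.
Proof.
case: a => p ts /=; congr Atom; apply: functional_extensionality_dep => i.
exact: tsubst_comp.
Qed.

Lemma asubst_rename1 rho (Y : var) t a :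
  arename rho (asubst (subst1 Y t) a)
  = asubst (subst1 (rho Y) (trename rho t)) (arename rho a).
Proof.
rewrite /arename !asubst_comp; apply: asubst_agree => x _.
by rewrite /subst1 /= (inj_eq (@ren_inj rho)); case: eqP.
Qed.

Lemma builtin_all_closure A : builtin A -> builtin (all_closure A).
Proof. by rewrite /all_closure => bA; elim: (enum_fset _). Qed.

Lemma builtin_ex_vars (Z : seq var) A : builtin A -> builtin (ex_vars Z A).
Proof. by move=> bA; elim: Z. Qed.

Definition with_cint M (I : gatom M -> Prop) : structure Sg :=
  Structure (dom_inh M) (@fint _ M) (@bint _ M) (fun p ds => I (existT _ p ds)).

Lemma teval_with_cint M (I : gatom M -> Prop) (v : var -> dom M) t :
  @teval _ (with_cint I) v t = teval v t.
Proof.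
elim: t => //= f ts IH; congr fint.
by apply: functional_extensionality_dep => i; apply: IH.
Qed.

Lemma sat_with_cint M (I : gatom M -> Prop) (v : var -> dom M) A :
  builtin A -> @sat _ (with_cint I) v A <-> sat v A.
Proof.
elim: A v => //=.
- by move=> t u v _; rewrite !teval_with_cint.
- move=> p ts v _.
  by rewrite (_ : (fun i => @teval _ (with_cint I) v (ts i)) = (fun i => teval v (ts i))) //;
    apply: functional_extensionality_dep => i; rewrite teval_with_cint.
- by move=> A IHA B IHB v [/(IHA v)? /(IHB v)?]; tauto.
- by move=> A IHA B IHB v [/(IHA v)? /(IHB v)?]; tauto.
- by move=> A IHA B IHB v [/(IHA v)? /(IHB v)?]; tauto.
- by move=> x A IH v bA; split=> sA d; apply/IH.
- by move=> x A IH v bA; split=> -[d sA]; exists d; apply/IH.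
Qed.

Lemma sat_with_cint_FChr M (I : gatom M -> Prop) (v : var -> dom M) a :
  @sat _ (with_cint I) v (FChr a) <-> I (aeval v a).
Proof.
case: a => p ts /=.
by rewrite (_ : (fun i => @teval _ (with_cint I) v (ts i)) = (fun i => teval v (ts i))) //;
  apply: functional_extensionality_dep => i; rewrite teval_with_cint.
Qed.

End Logic.

(** * Renamings: extension of finite injections, fresh copies, gluing of valuations *)

Definition ren_id : renaming :=
  @Renaming id (Bijective (fun=> erefl) (fun=> erefl)).

Definition ren_comp (rho rho' : renaming) : renaming :=
  Renaming (bij_comp (ren_bij rho) (ren_bij rho')).

Definition swap (a b x : var) : var :=
  if x == a then b else if x == b then a else x.

Lemma swapK a b : involutive (swap a b).
Proof.
move=> x; rewrite /swap; case: (eqVneq x a) => [->|xa].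
  by rewrite eqxx; case: eqP.
by case: (eqVneq x b) => [->|xb]; rewrite ?eqxx // (negPf xa) (negPf xb).
Qed.

Lemma extend_to_renaming (f : var -> var) (A : {fset var}) :
  {in A &, injective f} -> exists rho : renaming, agree A rho f.
Proof.
suff ext (s : seq var) : {in s &, injective f} ->
    exists rho : renaming, {in s, rho =1 f}.
  by move=> /(ext (enum_fset A))[rho rhof]; exists rho.
elim: s => [|x s IH] inj_f; first by exists ren_id.
have [|rho rhof] := IH; first by move=> y z ys zs; apply: inj_f; rewrite inE ?ys ?zs orbT.
have [xs|xs] := boolP (x \in s).
  by exists rho => y; rewrite inE => /orP[/eqP->|]; apply: rhof.
(* A transposition after [rho] corrects the value at [x]. Earlier values survive: [f y] differs from
   [rho x] by injectivity of [rho], and from [f x] by injectivity of [f] on the list. *)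
exists (Renaming (bij_comp (inv_bij (swapK (rho x) (f x))) (ren_bij rho))) => y /=.
rewrite inE /swap => /orP[/eqP->|ys]; first by rewrite eqxx.
rewrite (inj_eq (@ren_inj rho)); case: eqP => [yx|_]; first by rewrite -yx ys in xs.
rewrite rhof //; case: eqP => // fyx; case/negP: xs.
by rewrite -(inj_f y x) // inE ?eqxx ?ys ?orbT.
Qed.

Lemma fresh_renaming (rho : renaming) (U A V : {fset var}) :
  exists rho' : renaming,
    agree U rho' rho /\ (forall x, x \in A -> x \notin U -> rho' x \notin V).
Proof.
have [N NV] := fset_bound (V `|` [fset rho x | x in U]).
(* [N] bounds both [V] and the image of [U], so shifting by [N] avoids [V] and cannot collide with a
   value kept on [U]. *)
pose f x := if x \in U then rho x else (x + N)%N.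
have [|rho' rhof] := @extend_to_renaming f (A `|` U).
  have lt x : x \in U -> (rho x < N)%N by move=> xU; apply: NV; rewrite inE in_imfset ?orbT.
  move=> x y _ _; rewrite /f; case: ifP => xU; case: ifP => yU.
  - exact: ren_inj.
  - by move=> rxy; have := lt _ xU; rewrite rxy ltnNge leq_addl.
  - by move=> rxy; have := lt _ yU; rewrite -rxy ltnNge leq_addl.
  - exact: addIn.
exists rho'; split=> [x xU|x xA xU]; rewrite rhof ?inE ?xA ?xU ?orbT // /f ?xU //.
rewrite (negPf xU); apply/negP => xV.
by have := NV (x + N)%N; rewrite inE xV ltnNge leq_addl => /(_ isT).
Qed.

(* Used for rho' obtained from rho by fresh_renaming: the old variables V keep
   their values, the fresh copies take those of u. *)
Lemma glue_valuation (T : Type) (rho rho' : renaming) (U A V : {fset var})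
    (v u : var -> T) :
  agree U rho' rho -> (forall x, x \in A -> x \notin U -> rho' x \notin V) ->
  agree U u (v \o rho) ->
  exists v', agree V v' v /\ agree (A `|` U) (v' \o rho') u.
Proof.
move=> rU rA uv; have [g rK gK] := ren_bij rho'.
exists (fun y => if y \in V then v y else u (g y)); split=> [x -> //|x xAU /=].
case: ifP => [rV|]; last by rewrite rK.
have [xU|xU] := boolP (x \in U); first by rewrite rU // uv.
move: xAU; rewrite inE (negPf xU) orbF => xA.
by move: (rA x xA xU); rewrite rV.
Qed.

(** * The abstract equivalence *)

Section Stores.
Variables (Sg : signature) (L : constraint_language Sg).
Implicit Types (S : seq (atom Sg)) (E F : seq (constraint L)) (X : {fset var}).
Implicit Types (M : structure Sg) (rho : renaming).

Definition holds M (v : var -> dom M) E : Prop := sat v (bconj E).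

Definition store_fv E : {fset var} := ffv (bconj E).

Lemma holds_cat M (v : var -> dom M) E F :
  holds v (E ++ F) <-> holds v E /\ holds v F.
Proof. by rewrite /holds /bconj map_cat sat_conj. Qed.

Lemma store_fv_cat E F : store_fv (E ++ F) = store_fv E `|` store_fv F.
Proof.
elim: E => [|A E IH]; first by rewrite [store_fv [::]]/= fset0U.
by rewrite -fsetUA -IH.
Qed.

Lemma holds_agree M (v w : var -> dom M) E :
  agree (store_fv E) v w -> holds v E -> holds w E.
Proof. by move=> vw; apply: (proj1 (sat_agree vw)). Qed.

Lemma bconj_rename rho E :
  bconj (map (crename rho) E) = frename rho (bconj E).
Proof. by elim: E => //= A E; rewrite /bconj /= => ->. Qed.

Lemma holds_rename M (v : var -> dom M) rho E :
  holds v (map (crename rho) E) <-> holds (v \o rho) E.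
Proof. by rewrite /holds bconj_rename sat_rename. Qed.

Lemma store_fv_rename rho E x :
  (rho x \in store_fv (map (crename rho) E)) = (x \in store_fv E).
Proof. by rewrite /store_fv bconj_rename ffv_rename. Qed.

Lemma holds_ceq M (v : var -> dom M) (t u : term Sg) E :
  holds v (ceq L t u :: E) <-> teval v t = teval v u /\ holds v E.
Proof. by []. Qed.

Lemma builtin_bconj E : builtin (bconj E).
Proof. by elim: E => //= A E IH; split=> //; apply: (lang_builtin (svalP A)). Qed.

Lemma coherent_builtin A : coherent L A -> builtin A.
Proof.
case=> C [D [Z ->]]; apply: builtin_all_closure; split; first exact: builtin_bconj.
exact/builtin_ex_vars/builtin_bconj.
Qed.

Variable CT : set (formula Sg).
Notation state := (state L).
Notation "s ~= s'" := (aequiv CT s s') (at level 70).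

Lemma ae_rst (s s' : state) : astep CT s s' -> s ~= s'.
Proof. exact: rst_step. Qed.

Lemma ae_refl (s : state) : s ~= s.
Proof. exact: rst_refl. Qed.

Lemma ae_sym (s s' : state) : s ~= s' -> s' ~= s.
Proof. exact: rst_sym. Qed.

Lemma ae_trans (s1 s2 s3 : state) : s1 ~= s2 -> s2 ~= s3 -> s1 ~= s3.
Proof. exact: rst_trans. Qed.

(** The clause [ae_store] read inside models: the values of goal and global variables are kept,
    while all others are existential on both sides and may be chosen anew. *)
Lemma ae_stores S E F X :
  (forall M (v : var -> dom M), model CT M -> holds v E ->
     exists v', agree (goal_fv S `|` X) v' v /\ holds v' F) ->
  (forall M (v : var -> dom M), model CT M -> holds v F ->
     exists v', agree (goal_fv S `|` X) v' v /\ holds v' E) ->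
  State S E X ~= State S F X.
Proof.
have imp E1 E2 M (v : var -> dom M) : model CT M ->
    (forall M (v : var -> dom M), model CT M -> holds v E1 ->
       exists v', agree (goal_fv S `|` X) v' v /\ holds v' E2) ->
    sat v (ex_except (goal_fv S `|` X) (bconj E1)) ->
    sat v (ex_except (goal_fv S `|` X) (bconj E2)).
  move=> MCT E12 /sat_ex_except[v1 [v1v /(E12 _ _ MCT)[v2 [v21 h2]]]].
  by apply/sat_ex_except; exists v2; split=> // x xX; rewrite v21 ?v1v.
by move=> EF FE; apply/ae_rst/ae_store => M MCT v; split; apply: imp.
Qed.

Lemma ae_store_inv S E F X M (v : var -> dom M) :
  entails CT (FIff (ex_except (goal_fv S `|` X) (bconj E))
                   (ex_except (goal_fv S `|` X) (bconj F))) ->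
  model CT M -> holds v E ->
  exists v', agree (goal_fv S `|` X) v' v /\ holds v' F.
Proof.
move=> EF MCT hE; have [EF1 _] := EF M MCT v.
by apply/sat_ex_except/EF1/sat_ex_except; exists v.
Qed.

Lemma ae_stores_iff S E F X :
  (forall M (v : var -> dom M), model CT M -> holds v E <-> holds v F) ->
  State S E X ~= State S F X.
Proof.
by move=> EF; apply: ae_stores => M v MCT /(EF _ _ MCT) h; exists v.
Qed.

(** The new valuation must also keep the variables of [E], so that [E] stays true; only variables
    new to the state are free for [F]. *)
Lemma ae_add S E F X :
  (forall M (v : var -> dom M), model CT M -> holds v E ->
     exists v', agree (goal_fv S `|` X `|` store_fv E) v' v /\ holds v' F) ->
  State S E X ~= State S (F ++ E) X.
Proof.
move=> EF; apply: ae_stores => M v MCT; last first.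
  by move=> /holds_cat[_ hE]; exists v.
move=> hE; have [v' [/agreeU[v'v v'E] hF]] := EF M v MCT hE.
exists v'; split=> //; apply/holds_cat; split=> //.
exact: holds_agree (agree_sym v'E) hE.
Qed.

Lemma ae_inconsistent S E X :
  (forall M (v : var -> dom M), model CT M -> ~ holds v E) ->
  State S E X ~= failed L.
Proof.
move=> noE; apply: (@ae_trans _ (State S [:: cfalse L] X)).
  by apply: ae_stores_iff => M v MCT; split=> [/(noE M v MCT)|[]].
apply: (@ae_trans _ (State [::] [:: cfalse L] X)); first exact/ae_rst/ae_false.
(* With an empty goal and the store [false] no variable occurs, so [ae_global] removes the globals
   one by one. *)
elim/fset1U_rect: X => [|x X _ IH]; first exact: ae_refl.
apply: ae_trans IH; apply/ae_sym/ae_rst/ae_global.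
by rewrite /goal_fv big_nil /= !inE.
Qed.

(* Through the state whose store defines the fresh variable z as t, hence as u. *)
Lemma ae_replace S z t u E X :
  (forall M (v : var -> dom M), model CT M -> holds v E -> teval v t = teval v u) ->
  z \notin X `|` store_fv E `|` tfv t `|` tfv u ->
  State (map (asubst (subst1 z t)) S) E X ~= State (map (asubst (subst1 z u)) S) E X.
Proof.
move=> tu; rewrite !inE !negb_or -!andbA => /and4P[zX zE zt zu].
have intro_z w : z \notin tfv w ->
    State (map (asubst (subst1 z w)) S) E X ~= State S (ceq L (Var z) w :: E) X.
  move=> zw; apply: (@ae_trans _ (State (map (asubst (subst1 z w)) S) (ceq L (Var z) w :: E) X)).
    apply: (@ae_add _ E [:: ceq L (Var z) w]) => M v MCT hE.
    exists (update v z (teval v w)); split.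
      apply: agree_update; rewrite !inE (negPf zX) (negPf zE) !orbF.
      elim: (S) => [|a S' IH] /=; first by rewrite /goal_fv big_nil inE.
      rewrite goal_fv_cons !inE (negPf IH) orbF.
      have zs t' : z \notin tfv (tsubst (subst1 z w) t').
        elim: t' => [x|f ts IHt] /=.
          by rewrite /subst1; case: eqP => [_ //|/eqP]; rewrite !inE eq_sym.
        by apply/negP => /tfv_App[i]; apply/negP.
      by case: a => p ts; apply/negP => /afv_Atom[i]; apply/negP.
    split=> //=; rewrite update_id; apply: teval_agree.
    exact/agree_sym/agree_update.
  exact/ae_sym/ae_rst/ae_subst.
apply: (ae_trans (intro_z t zt)); apply: (ae_trans _ (ae_sym (intro_z u zu))).
apply: ae_stores_iff => M v MCT; split=> /holds_ceq[zeq hE]; apply/holds_ceq; split=> //.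
  by rewrite zeq; apply: tu.
by rewrite zeq; apply/esym/tu.
Qed.

(** [ae_replace] exchanges one pair of terms, so the arguments are changed one at a time: [mixed k]
    has its first [k] arguments from [us] and the others from [ts]. *)
Lemma ae_replace_args S (p : csym Sg) (ts us : 'I_(carity p) -> term Sg) E X :
  (forall M (v : var -> dom M), model CT M -> holds v E ->
     forall i, teval v (ts i) = teval v (us i)) ->
  State (Atom ts :: S) E X ~= State (Atom us :: S) E X.
Proof.
move=> tu; pose mixed k := Atom (fun i : 'I_(carity p) => if (i < k)%N then us i else ts i).
have -> : Atom us = mixed (carity p).
  by congr Atom; apply: functional_extensionality_dep => i; rewrite ltn_ord.
suff: forall k, State (Atom ts :: S) E X ~= State (mixed k :: S) E X by apply.
elim=> [|k IH]; first exact: ae_refl.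
apply: (ae_trans IH); have [kp|pk] := ltnP k (carity p); last first.
  suff -> : mixed k = mixed k.+1 by apply: ae_refl.
  congr Atom; apply: functional_extensionality_dep => i.
  by rewrite !(leq_trans (ltn_ord i)) // ltnW.
pose j := Ordinal kp.
have [z] := fresh_var (X `|` store_fv E `|` tfv (ts j) `|` tfv (us j) `|` goal_fv S
  `|` afv (mixed k) `|` afv (mixed k.+1)).
rewrite !inE !negb_or -!andbA => /and5P[zX zE zt zu /and3P[zS zk zk1]].
(* Common template of [mixed k] and [mixed k.+1]: the fresh [z] stands at the only place [j] where
   they may differ. *)
pose az := Atom (fun i : 'I_(carity p) => if (i < k)%N then us i else if i == j then Var z else ts i).
have idS t : map (asubst (subst1 z t)) S = S.
  rewrite -[RHS]gsubst_Var; apply: gsubst_agree => x xS; rewrite /subst1.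
  by case: eqP => // xz; rewrite xz (negPf zS) in xS.
have idt (t u : term Sg) : z \notin tfv t -> tsubst (subst1 z u) t = t.
  move=> zt'; rewrite -[RHS]tsubst_Var; apply: tsubst_agree => x xt; rewrite /subst1.
  by case: eqP => // xz; rewrite xz (negPf zt') in xt.
have notin_arg k' (i : 'I_(carity p)) : z \notin afv (mixed k') -> z \notin tfv (if (i < k')%N then us i else ts i).
  by apply: contra => zi; apply/afv_Atom; exists i.
have -> : State (mixed k :: S) E X = State (map (asubst (subst1 z (ts j))) (az :: S)) E X.
  congr State; rewrite /= idS; congr (_ :: _); congr Atom.
  apply: functional_extensionality_dep => i; have := notin_arg k i zk.
  case: ltnP => [_ zi|ki zi]; first by rewrite idt.
  by case: eqP => [->|_]; [rewrite /= /subst1 eqxx | rewrite idt].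
have -> : State (mixed k.+1 :: S) E X = State (map (asubst (subst1 z (us j))) (az :: S)) E X.
  congr State; rewrite /= idS; congr (_ :: _); congr Atom.
  apply: functional_extensionality_dep => i; have := notin_arg k.+1 i zk1.
  rewrite ltnS; case: (ltngtP i k) => [_ zi|ki zi|ik _].
  - by rewrite idt.
  - by rewrite (_ : (i == j) = false) ?idt //; apply/eqP => ij; rewrite ij ltnn in ki.
  - have -> : i = j by apply: val_inj.
    by rewrite eqxx /= /subst1 eqxx.
apply: ae_replace; last by rewrite !inE !negb_or zX zE zt zu.
by move=> M v MCT hE; apply: tu.
Qed.

Lemma perm_ae S S' E X : Permutation S S' -> State S E X ~= State S' E X.
Proof. by move=> SS'; apply/ae_rst/ae_perm. Qed.

(** Equality of dependent pairs gives equality of the second components only up to a transport;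
    proof irrelevance turns that transport into the identity. *)
Lemma gatom_inj M (p : csym Sg) (f g : 'I_(carity p) -> dom M) :
  existT _ p f = existT _ p g :> gatom M -> f = g.
Proof.
by move=> fg; have := EqdepFacts.eq_sigT_snd fg; rewrite (Prop_irrelevance (EqdepFacts.eq_sigT_fst fg) erefl).
Qed.

(** [F] consists of the equations between corresponding arguments. They hold under this [v] without
    having to follow from [CT], and any store that entails them makes the two atoms interchangeable:
    [F] plays the part of a unifier. *)
Lemma match_atoms M (v : var -> dom M) (a b : atom Sg) :
  aeval v a = aeval v b ->
  exists F, [/\ holds v F, forall x, x \in store_fv F -> x \in afv a `|` afv b &
    forall S E X,
      (forall M (v : var -> dom M), model CT M -> holds v E -> holds v F) ->
      State (a :: S) E X ~= State (b :: S) E X].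
Proof.
case: a => p ts; case: b => q us /= tu.
have pq : p = q := congr1 (fun d : gatom M => projT1 d) tu.
case: q / pq us tu => us tu; have {}tu := gatom_inj tu.
pose F (s : seq 'I_(carity p)) := [seq ceq L (ts i) (us i) | i <- s].
have holdsF N (w : var -> dom N) s :
    holds w (F s) <-> (forall i, i \in s -> teval w (ts i) = teval w (us i)).
  elim: s => [|i s IH]; first by split.
  rewrite holds_ceq IH; split=> [[ti ts'] k|ts'].
    by rewrite inE => /orP[/eqP-> //|]; apply: ts'.
  split; first by apply: ts'; rewrite inE eqxx.
  by move=> k ks; apply: ts'; rewrite inE ks orbT.
exists (F (enum 'I_(carity p))); split.
- by apply/holdsF => i _; apply: (congr1 (fun h => h i) tu).
- elim: (enum _) => [|i s IH] x; first by rewrite inE.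
  rewrite [store_fv _]/= => /fsetUP[/fsetUP[] xi|/IH //]; apply/fsetUP.
    by left; apply/afv_Atom; exists i.
  by right; apply/afv_Atom; exists i.
- move=> S E X EF; apply: ae_replace_args => N w NCT /(EF N w NCT)/holdsF h i.
  by apply: h; rewrite mem_enum.
Qed.

Lemma match_goals M (v : var -> dom M) (S1 S2 : seq (atom Sg)) :
  map (aeval v) S1 = map (aeval v) S2 ->
  exists F, [/\ holds v F, forall x, x \in store_fv F -> x \in goal_fv S1 `|` goal_fv S2 &
    forall S E X,
      (forall M (v : var -> dom M), model CT M -> holds v E -> holds v F) ->
      State (S1 ++ S) E X ~= State (S2 ++ S) E X].
Proof.
elim: S1 S2 => [|a S1 IH] [|b S2] //=.
  by move=> _; exists [::]; split=> // *; apply: ae_refl.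
case=> /match_atoms[F [hF Fv Fae]] /IH[F' [hF' F'v F'ae]].
exists (F ++ F'); split; first exact/holds_cat.
  move=> x; rewrite store_fv_cat !goal_fv_cons => /fsetUP[/Fv|/F'v] /fsetUP[];
  by rewrite !inE => ->; rewrite ?orbT.
move=> S E X EF; apply: (@ae_trans _ (State (b :: S1 ++ S) E X)).
  by apply: Fae => N w NCT /(EF N w NCT)/holds_cat[].
apply: (@ae_trans _ (State (S1 ++ b :: S) E X)); first exact/perm_ae/Permutation_middle.
apply: (@ae_trans _ (State (S2 ++ b :: S) E X)).
  by apply: F'ae => N w NCT /(EF N w NCT)/holds_cat[].
exact/perm_ae/Permutation_sym/Permutation_middle.
Qed.

End Stores.

(** * Simulation of derivations in instances of a state *)

Section Variants.
Variables (Sg : signature) (L : constraint_language Sg).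
Implicit Types (r : rule L) (rho : renaming).

Lemma trename_comp rho rho' (t : term Sg) :
  trename rho (trename rho' t) = trename (ren_comp rho rho') t.
Proof. by rewrite /trename tsubst_comp. Qed.

Lemma arename_comp rho rho' (a : atom Sg) :
  arename rho (arename rho' a) = arename (ren_comp rho rho') a.
Proof. by rewrite /arename asubst_comp. Qed.

Lemma frename_comp rho rho' (A : formula Sg) :
  frename rho (frename rho' A) = frename (ren_comp rho rho') A.
Proof.
elim: A => //= [t u|p ts|a|A -> B -> //|A -> B -> //|A -> B -> //|x A -> //|x A -> //].
- by rewrite !trename_comp.
- by congr FPred; apply: functional_extensionality_dep => i; rewrite trename_comp.
- by rewrite arename_comp.
Qed.

Lemma crename_comp rho rho' (c : constraint L) :
  crename rho (crename rho' c) = crename (ren_comp rho rho') c.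
Proof. by apply: eq_exist; rewrite /= frename_comp. Qed.

Lemma variant_rename (P : program L) rho r :
  variant P r -> variant P (rule_rename rho r).
Proof.
case=> r0 [rho0 [Pr0 ->]].
exists r0, (ren_comp rho rho0); split=> //.
rewrite /rule_rename /= -!map_comp.
set rho1 := ren_comp rho rho0.
have eqa (a : atom Sg) : (arename rho \o arename rho0) a = arename rho1 a.
  exact: arename_comp.
have eqc (c : constraint L) : (crename rho \o crename rho0) c = crename rho1 c.
  exact: crename_comp.
by rewrite !(eq_map eqa) !(eq_map eqc).
Qed.

Lemma variant_id (P : program L) r : List.In r P -> variant P r.
Proof.
move=> Pr; exists r, ren_id; split=> //; case: r {Pr} => K H G C B; rewrite /rule_rename /=.
have ida S : map (arename ren_id) S = S :> seq (atom Sg).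
  by rewrite -[RHS]gsubst_Var; apply: gsubst_agree.
have idf (A : formula Sg) : frename ren_id A = A.
  have idt (t : term Sg) : trename ren_id t = t by rewrite -[RHS]tsubst_Var.
  elim: A => //= [t u|p ts|a|A -> B' -> //|A -> B' -> //|A -> B' -> //|x A -> //|x A -> //].
  - by rewrite !idt.
  - by congr FPred; apply: functional_extensionality_dep => i; rewrite idt.
  - by congr FChr; rewrite /arename asubst_Var.
have idc E : map (crename ren_id) E = E :> seq (constraint L).
  by elim: E => //= c E ->; congr (_ :: _); case: c => A LA; apply: eq_exist; rewrite idf.
by rewrite !ida !idc.
Qed.

Definition rule_vars r : {fset var} :=
  head_fv r `|` (store_fv (guard r) `|` store_fv (body_builtin r) `|` goal_fv (body_chr r)).

Lemma local_vars_sub r x : x \in local_vars r -> x \in rule_vars r.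
Proof. by move=> /fsetDP[xr _]; rewrite in_fsetU orbC; apply/orP; left. Qed.

Lemma rule_vars_split r x : x \in rule_vars r -> x \in head_fv r \/ x \in local_vars r.
Proof.
rewrite in_fsetU in_fsetD; have [//|_ /=] := boolP (x \in head_fv r); first by left.
by right.
Qed.

Lemma head_fv_rename rho r x : (rho x \in head_fv (rule_rename rho r)) = (x \in head_fv r).
Proof. by rewrite !inE /= !goal_fv_rename. Qed.

Lemma local_vars_rename rho r x :
  (rho x \in local_vars (rule_rename rho r)) = (x \in local_vars r).
Proof.
by rewrite !in_fsetD head_fv_rename !in_fsetU /= goal_fv_rename !store_fv_rename.
Qed.

Lemma ren_surj rho y : exists x, rho x = y.
Proof. by have [g _ gK] := ren_bij rho; exists (g y). Qed.

End Variants.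

Section Transitions.
Variables (Sg : signature) (L : constraint_language Sg).
Variables (CT : set (formula Sg)) (P : program L).
Implicit Types (S D : seq (atom Sg)) (E F : seq (constraint L)) (X : {fset var}).
Implicit Types (rho : renaming).
Notation state := (state L).
Notation "s ~= s'" := (aequiv CT s s') (at level 70).
Notation "s ->> s'" := (steps (aequiv CT) P s s') (at level 70).

Lemma steps_ae (s s' : state) : s ~= s' -> s ->> s'.
Proof. by move=> ss'; apply: t_step; right. Qed.

Lemma steps_refl (s : state) : s ->> s.
Proof. exact/steps_ae/ae_refl. Qed.

Lemma steps_comp (s1 s2 s3 : state) : s1 ->> s2 -> s2 ->> s3 -> s1 ->> s3.
Proof. exact: t_trans. Qed.

Lemma steps_rule (r : rule L) D E X :
  variant P r -> [disjoint local_vars r & X] ->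
  [disjoint local_vars r & goal_fv D `|` store_fv E] ->
  State (kept r ++ removed r ++ D) (guard r ++ E) X ->>
  State (body_chr r ++ kept r ++ D) (body_builtin r ++ guard r ++ E) X.
Proof. by move=> Pr rX rDE; apply: t_step; left; apply: trans_rule. Qed.

Definition state_fv (s : state) : {fset var} := goal_fv (goal s) `|` store_fv (store s).

(* s' is an instance of s with a stronger store and more globals.  The renaming
   may move locals of s, but only out of the globals of s', so that a variable
   which becomes global in s can be made fixed by the renaming. *)
Record refines (rho : renaming) (s' s : state) : Prop := Refines {
  refines_goal : goal s' = map (arename rho) (goal s);
  refines_store : forall M (v : var -> dom M), model CT M ->
    holds v (store s') -> holds (v \o rho) (store s);
  refines_globals : {subset globals s <= globals s'};
  refines_fv : {subset state_fv s <= globals s'};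
  refines_id : forall x, x \in globals s -> rho x = x;
  refines_fresh : forall x, x \in globals s' -> rho x = x \/ rho x \notin globals s' }.

(* Z collects the variables of the derivation: once they are all global in s',
   globals never have to be added to s' in the simulation. *)
Definition simulated (s t : state) : Prop :=
  exists Z : {fset var}, forall (s' : state) (rho : renaming), {subset Z <= globals s'} -> refines rho s' s ->
    exists t' rho', [/\ s' ->> t', globals t' = globals s' & refines rho' t' t].

Lemma simulated_refl s : simulated s s.
Proof.
by exists fset0 => s' rho _ ss'; exists s', rho; split=> //; apply: steps_refl.
Qed.

Lemma simulated_trans s t u : simulated s t -> simulated t u -> simulated s u.
Proof.
move=> [Z sim] [Z' sim']; exists (Z `|` Z') => s' rho ZZ ss'.
have [|t' [rho' [st tX tt']]] := sim s' rho _ ss'.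
  by move=> x xZ; apply: ZZ; rewrite inE xZ.
have [|u' [rho'' [tu uX uu']]] := sim' t' rho' _ tt'.
  by rewrite tX => x xZ; apply: ZZ; rewrite inE xZ orbT.
exists u', rho''; split=> //; first exact: steps_comp st tu.
by rewrite uX.
Qed.

(** Prepares a step that introduces local variables: [rho] is kept on [U], the variables that still
    matter, and the others are sent outside [V]. As [V] contains the globals of [s'], the conditions
    [refines_id] and [refines_fresh] survive. *)
Lemma refresh s' s rho (U A V : {fset var}) : refines rho s' s ->
  {subset globals s <= U} -> {subset globals s' <= V} ->
  exists rho' : renaming,
    [/\ agree U rho' rho,
        forall x, x \in A `|` globals s' -> x \notin U -> rho' x \notin V,
        forall x, x \in globals s -> rho' x = x &
        forall x, x \in globals s' -> rho' x = x \/ rho' x \notin globals s'].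
Proof.
move=> ss' sU s'V; have [rho' [rU rV]] := fresh_renaming rho U (A `|` globals s') V.
exists rho'; split=> // [x xs|x xs']; first by rewrite rU ?sU ?(refines_id ss').
have [xU|xU] := boolP (x \in U); first by rewrite rU //; apply: refines_fresh ss' _ _.
right; apply: contra (rV x _ xU); first exact: s'V.
by rewrite inE xs' orbT.
Qed.

Lemma simulated_store S E F X :
  (forall M (v : var -> dom M), model CT M -> holds v E ->
     exists v', agree (goal_fv S `|` X) v' v /\ holds v' F) ->
  simulated (State S E X) (State S F X).
Proof.
move=> EF; exists (state_fv (State S F X)) => s' rho Z ss'.
case: s' Z ss' => S' E' X' Z ss'; have /= gS := refines_goal ss'; rewrite /= in Z.
pose U := goal_fv S `|` X.
have [|x|rho' [rU rV rX rfr]] := @refresh _ _ _ U (store_fv F)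
    (goal_fv S' `|` X' `|` store_fv E') ss'.
- by move=> x /=; rewrite inE orbC => ->.
- by rewrite !inE => ->; rewrite orbT.
(* [E'] may say more than [E], so it stays; a copy of [F] whose variables outside [S] and [X] are
   fresh is added to it. *)
exists (State S' (map (crename rho') F ++ E') X'), rho'; split=> //.
  apply/steps_ae/ae_add => M v MCT hE'.
  have [u [uU hF]] := EF M _ MCT (refines_store ss' MCT hE').
  have [v' [v'v v'u]] := glue_valuation rU rV uU.
  exists v'; split=> //; apply/holds_rename; apply: holds_agree hF.
  by apply/agree_sym/(agree_sub _ v'u) => x xF; rewrite !inE xF.
split=> //=.
- by rewrite gS; apply/grename_agree/agree_sym/(agree_sub _ rU) => x xS; rewrite inE xS.
- by move=> M v MCT /holds_cat[/holds_rename].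
- exact: refines_globals ss'.
Qed.

(** Both directions are proved together because [aequiv] closes [astep] under symmetry. *)
Lemma simulated_astep s t : astep CT s t -> simulated s t /\ simulated t s.
Proof.
have perm S S' E X : Permutation S S' -> simulated (State S E X) (State S' E X).
  move=> SS'; exists fset0 => -[T F X'] rho _ [/= gS hE gX fv rid rfr].
  exists (State (map (arename rho) S') F X'), rho; split=> //.
    by apply/steps_ae/perm_ae; rewrite gS; apply: Permutation_map.
  by split=> // x xS; apply: fv; move: xS; rewrite /state_fv /= (goal_fv_perm SS').
have inconsistent S S' X : simulated (State S [:: cfalse L] X) (State S' [:: cfalse L] X).
  exists (state_fv (State S' [:: cfalse L] X)) => -[T F X'] rho Z [/= gS hE gX fv rid rfr].
  exists (State (map (arename rho) S') [:: cfalse L] X'), rho; split=> //.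
    apply/steps_ae/(@ae_trans _ _ _ _ (State T [:: cfalse L] X')); last exact/ae_rst/ae_false.
    by apply: ae_stores_iff => M v MCT; split=> [/(hE _ _ MCT)|[]].
have glob S E X Y : Y \notin (goal_fv S `|` store_fv E) ->
    simulated (State S E X) (State S E (Y |` X)).
  move=> YSE; exists [fset Y] => -[T F X'] rho Z [/= gS hE gX fv rid rfr].
  have YX' : Y \in X' by apply: Z; rewrite inE.
  (* A variable that becomes global must be fixed. By [refines_fresh] no other variable of [X'] is
     mapped to [Y], so resetting the value at [Y] keeps injectivity on [X']; the goal and the store
     do not contain [Y], so the instance is unchanged. *)
  pose f x := if x == Y then Y else rho x.
  have [|rho' rf] := @extend_to_renaming f X'.
    have rY x : x \in X' -> rho x = Y -> x = Y.
      by move=> xX' rxY; case: (rfr x xX'); rewrite rxY // YX'.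
    move=> x y xX' yX'; rewrite /f; case: eqP => [->|xY]; case: eqP => [->|yY] //.
    + by move=> /esym/(rY _ yX')/esym.
    + by move=> /(rY _ xX').
    + exact: ren_inj.
  have rr : agree (goal_fv S `|` store_fv E) rho' rho.
    move=> x xSE; rewrite rf; last exact: fv.
    by rewrite /f; case: eqP => // xY; rewrite xY (negPf YSE) in xSE.
  have [rS rE] := (proj1 (agreeU _ _ _ _) rr).
  exists (State T F X'), rho'; split=> //; first exact: steps_refl.
  split=> //=.
  - by rewrite gS; apply/grename_agree/agree_sym.
  - move=> M v MCT /(hE _ _ MCT); apply: holds_agree => x xE /=.
    by rewrite rE.
  - by move=> x /fset1UP[-> //|/gX].
  - move=> x /fset1UP[->|xX]; first by rewrite rf // /f eqxx.
    by rewrite rf ?gX // /f; case: eqP => // _; apply: rid.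
  - move=> x xX'; rewrite rf // /f; case: eqP => [->|_]; first by left.
    exact: rfr.
have unglob S E X Y : simulated (State S E (Y |` X)) (State S E X).
  exists fset0 => -[T F X'] rho Z [/= gS hE gX fv rid rfr].
  exists (State T F X'), rho; split=> //; first exact: steps_refl.
  by split=> //= x xX; [apply: gX|apply: rid]; rewrite !inE xX orbT.
have subst S S' Y u E X :
    (forall rho F (Z : {fset var}),
      (forall M (v : var -> dom M), model CT M -> holds v F ->
         holds (v \o rho) (ceq L (Var Y) u :: E)) ->
      State (map (arename rho) S) F Z ~= State (map (arename rho) S') F Z) ->
    simulated (State S (ceq L (Var Y) u :: E) X) (State S' (ceq L (Var Y) u :: E) X).
  move=> SS'; exists (state_fv (State S' (ceq L (Var Y) u :: E) X)) => -[T F X'] rho Z.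
  move=> [/= gS hE gX fv rid rfr].
  exists (State (map (arename rho) S') F X'), rho; split=> //.
  by apply: steps_ae; rewrite gS; apply: SS'.
case=> {s t}.
- by move=> S S' E X SS'; split; apply: perm => //; apply: Permutation_sym.
- move=> S Y t D X.
  have eqv rho F (Z : {fset var}) :
      (forall M (v : var -> dom M), model CT M -> holds v F ->
         holds (v \o rho) (ceq L (Var Y) t :: D)) ->
      State (map (arename rho) S) F Z
      ~= State (map (arename rho) (map (asubst (subst1 Y t)) S)) F Z.
    (* The renamed equation follows from [F], so it can be put into the store for the substitution
       and removed afterwards. *)
    move=> hF; set c := ceq L (Var (rho Y)) (trename rho t).
    have addc S' : State S' F Z ~= State S' (c :: F) Z.
      apply: ae_stores_iff => M v MCT; split=> [hFv|/holds_ceq[] //].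
      apply/holds_ceq; split=> //; have /holds_ceq[/= -> _] := hF M v MCT hFv.
      by rewrite /trename teval_subst.
    apply: (ae_trans (addc _)); apply: (ae_trans _ (ae_sym (addc _))).
    have -> : map (arename rho) (map (asubst (subst1 Y t)) S)
        = map (asubst (subst1 (rho Y) (trename rho t))) (map (arename rho) S).
      by rewrite -!map_comp; apply: eq_map => a /=; apply: asubst_rename1.
    exact/ae_rst/ae_subst.
  by split; apply: subst => rho F Z /eqv // h; apply: ae_sym.
- by move=> S S' X; split; apply: inconsistent.
- move=> S D E X DE; split; apply: simulated_store => M v MCT h.
    exact: ae_store_inv DE MCT h.
  by apply: ae_store_inv _ MCT h => N NCT w; have [] := DE N NCT w.
- by move=> S E X Y YSE; split; [apply: glob|apply: unglob].
Qed.

Lemma simulated_aequiv s t : s ~= t -> simulated s t.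
Proof.
move=> st; suff [] : simulated s t /\ simulated t s by [].
elim: st => {s t} [s t /simulated_astep //|s|s t _ [] //|s t u _ [st ts] _ [tu ut]].
  by split; apply: simulated_refl.
by split; apply: simulated_trans; eassumption.
Qed.

Lemma simulated_rule (r : rule L) D E X :
  variant P r -> [disjoint local_vars r & X] ->
  [disjoint local_vars r & goal_fv D `|` store_fv E] ->
  simulated (State (kept r ++ removed r ++ D) (guard r ++ E) X)
            (State (body_chr r ++ kept r ++ D) (body_builtin r ++ guard r ++ E) X).
Proof.
move=> Pr /fdisjointP rX /fdisjointP rDE.
set s := State _ _ _; set t := State _ _ _.
exists (state_fv t) => -[S' E' X'] rho Z ss'; have /= gS := refines_goal ss'; rewrite /= in Z.
pose U := (head_fv r `|` goal_fv D) `|` (store_fv E `|` X).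
have UE x : x \in local_vars r -> x \notin U.
  move=> xr; have xrX := rX x xr; have := rDE x xr; rewrite in_fsetU negb_or => /andP[xD xE].
  have /fsetDP[_ xh] := xr.
  by rewrite 3!in_fsetU (negPf xrX) (negPf xD) (negPf xE) (negPf xh).
have [x xX|x|rho' [rU rV rid rfr]] := @refresh _ _ _ U (local_vars r)
    (goal_fv S' `|` X' `|` store_fv E') ss'.
- by move: xX; rewrite !in_fsetU /= => ->; rewrite !orbT.
- by rewrite !in_fsetU => ->; rewrite orbT.
pose r' := rule_rename rho' r.
have head_goal : S' = kept r' ++ removed r' ++ map (arename rho') D.
  rewrite gS /= -!map_cat; apply/grename_agree/agree_sym/(agree_sub _ rU) => x.
  by rewrite /U !goal_fv_cat !in_fsetU => /orP[->|/orP[->|->]]; rewrite ?orbT.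
have fresh y : y \in local_vars r' -> y \notin goal_fv S' `|` X' `|` store_fv E'.
  have [x <-] := ren_surj rho' y; rewrite local_vars_rename => xr.
  by apply: rV; [rewrite in_fsetU xr | apply: UE].
exists (State (body_chr r' ++ kept r' ++ map (arename rho') D)
              (body_builtin r' ++ guard r' ++ E') X'), rho'; split=> //.
  (* In the instance the images of the rule's local variables under [rho] may occur in [E'] or be
     global. The rule is applied with fresh copies instead, and their guard may be added since they
     can take the values of the old images. *)
  apply: (@steps_comp _ (State S' (guard r' ++ E') X')).
    apply/steps_ae/ae_add => M v MCT hE'.
    have hG := refines_store ss' MCT hE'; move: hG => /holds_cat[hG _].
    have [v' [v'v v'u]] := glue_valuation rU rV (fun x _ => erefl ((v \o rho) x)).
    have gv : agree U (v' \o rho') (v \o rho).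
      by apply: (agree_sub _ v'u) => x xU; rewrite in_fsetU xU orbT.
    exists v'; split=> //; apply/holds_rename; apply: holds_agree hG.
    apply/agree_sym/(agree_sub _ v'u) => x xG.
    have /rule_vars_split[xh|xl] : x \in rule_vars r by rewrite !in_fsetU xG !orbT.
      by rewrite 4!in_fsetU xh !orbT.
    by rewrite 2!in_fsetU xl.
  rewrite head_goal; apply: steps_rule; first exact: variant_rename.
    apply/fdisjointP => y /fresh; apply: contra; rewrite !in_fsetU => ->.
    by rewrite orbT.
  apply/fdisjointP => y /fresh; apply: contra.
  rewrite head_goal !goal_fv_cat !in_fsetU => /orP[->|->]; by rewrite !orbT.
split=> //=.
- by rewrite !map_cat.
- move=> M v MCT; rewrite !holds_cat => -[/holds_rename hC [/holds_rename hG hE']].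
  split=> //; split=> //; have /holds_cat[_] := refines_store ss' MCT hE'.
  by apply: holds_agree => x xE /=; rewrite rU // !in_fsetU xE !orbT.
- exact: refines_globals ss'.
Qed.

Lemma simulated_steps s t : s ->> t -> simulated s t.
Proof.
have tr s' t' : trans (aequiv CT) P s' t' -> simulated s' t'.
  elim=> {s' t'} [r D E X Pr rX rDE|s1 s2 s3 s4 s12 _ s23 s34]; first exact: simulated_rule.
  apply: (simulated_trans (simulated_aequiv s12)).
  exact: (simulated_trans s23 (simulated_aequiv s34)).
elim=> {s t} [s t [/tr //|/simulated_aequiv //]|s t u _ st _].
exact: simulated_trans.
Qed.

End Transitions.

(** * Ground success *)

Section Success.
Variables (Sg : signature) (L : constraint_language Sg).
Variables (CT : set (formula Sg)) (P : program L) (M : structure Sg).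
Implicit Types (S D : seq (atom Sg)) (E F : seq (constraint L)) (X V : {fset var}).
Implicit Types (rho : renaming) (v w u : var -> dom M) (G : seq (gatom M)).
Notation state := (state L).
Notation "s ~= s'" := (aequiv CT s s') (at level 70).
Notation "s ->> s'" := (steps (aequiv CT) P s s') (at level 70).

(** A valuation chosen at each step takes the place of a variant renamed apart; [G'] is the
    untouched context. *)
Inductive ground_success : seq (gatom M) -> Prop :=
| ground_nil : ground_success [::]
| ground_rule r v G G' :
    List.In r P -> holds v (guard r) -> holds v (body_builtin r) ->
    Permutation G (map (aeval v) (kept r ++ removed r) ++ G') ->
    ground_success (map (aeval v) (body_chr r ++ kept r) ++ G') ->
    ground_success G.

Lemma ground_success_perm G G' :
  Permutation G G' -> ground_success G -> ground_success G'.
Proof.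
move=> GG' sG; case: sG GG' => [/Permutation_nil -> //|]; first exact: ground_nil.
move=> r v G0 D Pr hG hC pG sD GG'; apply: (ground_rule Pr hG hC _ sD).
exact: Permutation_trans (Permutation_sym GG') pG.
Qed.

(** The rewriting of [G] runs with [G'] as additional context, and that of [G'] follows. *)
Lemma ground_success_cat G G' :
  ground_success G -> ground_success G' -> ground_success (G ++ G').
Proof.
move=> sG sG'; elim: sG => // r v {}G D Pr hG hC pG _ IH.
apply: (ground_rule (G' := D ++ G') Pr hG hC); last by rewrite catA.
by rewrite catA; apply: Permutation_app_tail.
Qed.

(** Only the values of the globals are prescribed by [w]; the locals are existential, as in the
    logical reading of a state, which makes the notion invariant under [aequiv]. *)
Definition succeeds (s : state) w : Prop :=
  exists v, [/\ agree (globals s) v w, holds v (store s) &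
    ground_success (map (aeval v) (goal s))].

Hypothesis MCT : model CT M.

Lemma succeeds_astep s t w : astep CT s t -> succeeds s w <-> succeeds t w.
Proof.
case=> {s t}.
- move=> S S' E X SS'; split=> -[v [vX hE sS]]; exists v; split=> //.
    by apply: ground_success_perm sS; apply: Permutation_map.
  by apply: ground_success_perm sS; apply/Permutation_sym/Permutation_map.
- move=> S Y t E X.
  by split=> -[v [vX hE sS]]; exists v; split=> //; move: sS;
    have /holds_ceq[Yt _] := hE; rewrite /= geval_subst1.
- by move=> S S' X; split=> -[v [_ []]].
- move=> S E F X EF.
  have tr E1 E2 : (forall v, holds v E1 -> exists v', agree (goal_fv S `|` X) v' v /\ holds v' E2) ->
      succeeds (State S E1 X) w -> succeeds (State S E2 X) w.
    move=> E12 [v [vX /E12[v' [/agreeU[v'S v'X] hE2]] sS]]; exists v'; split=> //.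
      by move=> x xX; rewrite v'X ?vX.
    by move: sS; rewrite /= (geval_agree v'S).
  split; apply: tr => v; apply: ae_store_inv MCT => // N NCT u.
  by have [] := EF N NCT u.
- move=> S E X Y; rewrite -/(store_fv E) => YSE; split=> -[v [vX hE sS]]; last first.
    by exists v; split=> // x xX; apply: vX; rewrite inE xX orbT.
  have /agreeU[uS uE] := agree_update v (w Y) YSE.
  (* [Y] does not occur in the state, so it can take the value that [w] prescribes once it is
     global. *)
  exists (update v Y (w Y)); split; last by rewrite /= (geval_agree uS).
    move=> x /=; rewrite in_fset1U => /orP[/eqP ->|xX]; first by rewrite update_id.
    by rewrite /update; case: eqP => [->|_] //; apply: vX.
  exact: holds_agree (agree_sym uE) hE.
Qed.

Lemma succeeds_aequiv s t w : s ~= t -> succeeds s w <-> succeeds t w.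
Proof.
elim=> {s t} [s t /succeeds_astep //|s //|s t _ ->//|s t u _ -> _ -> //].
Qed.

(** A rule step only enlarges the store, so a valuation for the target also fits the source;
    composed with the renaming of the variant, it is the valuation of a ground step. *)
Lemma succeeds_expansion s t w : s ->> t -> succeeds t w -> succeeds s w.
Proof.
have tr s' t' : trans (aequiv CT) P s' t' -> succeeds t' w -> succeeds s' w.
  elim=> {s' t'} [_ D E X [r [rho [Pr ->]]] _ _|s1 s2 s3 s4 s12 _ s23 s34].
    move=> [v [vX /holds_cat[hC /holds_cat[hG hE]] sB]]; exists v; split=> //.
      exact/holds_cat.
    move: hC hG => /holds_rename hC /holds_rename hG.
    apply: (@ground_rule r (v \o rho) _ (map (aeval v) D) Pr hG hC).
      by rewrite /= !map_cat !geval_rename catA.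
    by move: sB; rewrite /= !map_cat !geval_rename catA.
  by move=> /(succeeds_aequiv w s34)/s23/(succeeds_aequiv w s12).
elim=> {s t} [s t [/tr //|/(succeeds_aequiv w)[] //]|s t u _ st _ tu /tu/st //].
Qed.

(** The store of a succeeding state is true in [M], so [ae_false] does not apply to it, and rules
    have nonempty heads; hence an answer can only move within its equivalence class. *)
Lemma answer_steps s t w : s ->> t -> goal s = [::] -> succeeds s w ->
  goal t = [::] /\ succeeds t w.
Proof.
have st s' t' : astep CT s' t' \/ astep CT t' s' -> goal s' = [::] -> succeeds s' w ->
    goal t' = [::].
  case=> -[] // S S'.
  - by move=> E X SS' /= S0; move: SS'; rewrite S0 => /Permutation_nil.
  - by move=> E X X' /= ->.
  - by move=> X /= _ [v [_ []]].
  - by move=> E X SS' /= S0; move: SS'; rewrite S0 => /Permutation_sym/Permutation_nil.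
  - by move=> t0 E X /=; case: S.
  - by move=> X /= _ [v [_ []]].
have ae s' t' : s' ~= t' ->
    succeeds s' w -> (goal s' = [::] <-> goal t' = [::]).
  elim=> {s' t'} [s' t' s't' ss'|//|s' t' s't' IH st'|s1 s2 s3 s12 IH1 s23 IH2 ss].
  - split=> g; first by apply: st g ss'; left.
    by apply: (st t' s') g _; [right|apply/(succeeds_astep w s't')].
  - by rewrite IH //; apply/(succeeds_aequiv w s't').
  - by rewrite IH1 // IH2 //; apply/(succeeds_aequiv w s12).
have tr s' t' : trans (aequiv CT) P s' t' -> goal s' = [::] -> succeeds s' w -> False.
  elim=> {s' t'} [_ D E X [r [rho [Pr ->]]] _ _ /=|s1 s2 s3 s4 s12 _ s23 _ g1 ss1].
    have := rules_head Pr; case: (kept r) => //=; case: (removed r) => //.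
  by apply: s23; [apply/(ae _ _ s12)|apply/(succeeds_aequiv w s12)].
elim=> {s t} [s t [/tr h g /(h g) //|st' g ss]|s t u _ IH1 _ IH2 g ss].
  by split; [apply/(ae _ _ st')|apply/(succeeds_aequiv w st')].
by have [gt st'] := IH1 g ss; apply: IH2.
Qed.

(** Elements of [M] need not be values of closed terms, so a ground context becomes symbolic by
    taking new variables as arguments. *)
Lemma represent_atoms v G V : exists S v',
  [/\ map (aeval v') S = G, agree V v' v & forall x, x \in goal_fv S -> x \notin V].
Proof.
elim: G => [|[p ds] G [S [v1 [v1S v1V SV]]]].
  by exists [::], v; split=> // x; rewrite /goal_fv big_nil.
have [N NV] := fset_bound (V `|` goal_fv S).
(* The variable [N + i] receives the [i]-th argument; the default [v1 x] applies only past the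
   arity, where the new atom has no variable. *)
pose v2 x := if (x < N)%N then v1 x else oapp ds (v1 x) (insub (x - N)%N).
have v21 : agree (V `|` goal_fv S) v2 v1 by move=> x /NV xN; rewrite /v2 xN.
have /agreeU[v2V v2S] := v21.
exists (@Atom Sg p (fun i => Var (N + i)%N) :: S), v2; split.
- rewrite /= (geval_agree v2S) v1S; congr (existT _ p _ :: _).
  apply: functional_extensionality_dep => i /=.
  by rewrite /v2 ltnNge leq_addr /= addKn valK.
- by move=> x xV; rewrite v2V ?v1V.
- move=> x; rewrite goal_fv_cons => /fsetUP[/afv_Atom[i]|/SV //].
  rewrite inE => /eqP ->; apply/negP => iV.
  by have := NV (N + i)%N; rewrite in_fsetU iV ltnNge leq_addr => /(_ isT).
Qed.

Hypothesis confl : confluent (aequiv CT) P.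

(* Add to s the equations and the guard that make the first ground step an actual
   transition to t1, with all variables of s global.  The derivation s ->> t is
   simulated in this instance and joined with t1; success moves forward from t1
   by induction, and back from the join to the simulated t. *)
Lemma succeeds_reduction s t v :
  s ->> t -> holds v (store s) -> ground_success (map (aeval v) (goal s)) ->
  succeeds t v.
Proof.
move eG: (map _ _) => G st hs sG.
elim: sG s t v eG st hs => {G} [|r u G D Pr hG hC pG _ IH] s t v eG st hs.
  have gs : goal s = [::] by case: (goal s) eG.
  by have [] := @answer_steps s t v st gs; first by exists v; rewrite gs; split=> //; apply: ground_nil.
have [Z sim] := simulated_steps st.
pose V := state_fv s `|` globals s `|` Z `|` globals t.
have sV : {subset state_fv s <= V} by move=> x xs; rewrite 3!in_fsetU xs.
have XV : {subset globals s <= V} by move=> x xX; rewrite 3!in_fsetU xX orbT.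
have ZV : {subset Z <= V} by move=> x xZ; rewrite 2!in_fsetU xZ orbT.
have tV : {subset globals t <= V} by move=> x xX; rewrite in_fsetU xX orbT.
have [rho [_ rhoV]] := fresh_renaming ren_id fset0 (rule_vars r) V.
have [v' [v'v v'u]] : exists v', agree V v' v /\ agree (rule_vars r `|` fset0) (v' \o rho) u.
  by apply: (@glue_valuation _ rho rho fset0) => // x; rewrite inE.
rewrite fsetU0 in v'u; pose r' := rule_rename rho r.
have v'vs : agree (state_fv s) v' v := agree_sub sV v'v.
have [v'S v'E] := proj1 (agreeU _ _ _ _) v'vs.
have holdsu E : {subset store_fv E <= rule_vars r} -> holds u E -> holds v' (map (crename rho) E).
  by move=> Er hE; apply/holds_rename; apply: holds_agree hE; apply/agree_sym/(agree_sub _ v'u).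
have gevalu S : {subset goal_fv S <= rule_vars r} ->
    map (aeval v') (map (arename rho) S) = map (aeval u) S.
  by move=> Sr; rewrite geval_rename; apply/geval_agree/(agree_sub _ v'u).
have hG' : holds v' (guard r').
  by apply: holdsu => // x xG; rewrite !in_fsetU xG !orbT.
have hC' : holds v' (body_builtin r').
  by apply: holdsu => // x xG; rewrite !in_fsetU xG !orbT.
have eKH : map (aeval v') (kept r' ++ removed r') = map (aeval u) (kept r ++ removed r).
  rewrite /= -map_cat gevalu // => x; rewrite goal_fv_cat -/(head_fv r) !in_fsetU.
  by move=> ->.
have eBK : map (aeval v') (body_chr r' ++ kept r') = map (aeval u) (body_chr r ++ kept r).
  rewrite /= -map_cat gevalu // => x; rewrite goal_fv_cat !in_fsetU.
  by move=> /orP[] ->; rewrite ?orbT.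
move: pG; rewrite -eG -(geval_agree v'S) -eKH => /Permutation_sym.
(* The permutation of values lifts to one of the symbolic goal. Its first part [S1] has the same
   values as the heads of [r'], though not the same terms; [F] bridges the gap. *)
move=> /(@Permutation_map_inv _ _ (aeval v'))[Sp [eSp pSp]].
pose S1 := take (size (kept r' ++ removed r')) Sp.
pose S2 := drop (size (kept r' ++ removed r')) Sp.
have eS12 : Sp = S1 ++ S2 by rewrite cat_take_drop.
have eS1 : map (aeval v') S1 = map (aeval v') (kept r' ++ removed r').
  by rewrite map_take -[map (aeval v') Sp]eSp take_size_cat ?size_map.
have eS2 : map (aeval v') S2 = D.
  by rewrite map_drop -[map (aeval v') Sp]eSp drop_size_cat ?size_map.
have [F [hF Fv Fae]] := @match_goals _ L CT _ _ _ _ eS1.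
(* The fresh head variables become global too, but not the local variables of [r'], which a
   transition requires to be non-global. *)
pose X := V `|` head_fv r'.
pose E := guard r' ++ F ++ store s.
pose s' := State (goal s) E X.
have VX : {subset V <= X} by move=> x xV; rewrite in_fsetU xV.
have fresh y : y \in local_vars r' -> y \notin X.
  have [x <-] := ren_surj rho y; rewrite local_vars_rename => xr.
  have /fsetDP[_ xh] := xr; rewrite in_fsetU negb_or head_fv_rename xh andbT.
  by apply: rhoV; [apply: local_vars_sub | rewrite inE].
have gsV x : x \in goal_fv (S1 ++ S2) -> x \in X.
  by rewrite -eS12 -(goal_fv_perm pSp) => xs; apply/VX/sV; rewrite in_fsetU xs.
pose t1 := State (body_chr r' ++ kept r' ++ S2) (body_builtin r' ++ E) X.
have s't1 : s' ->> t1.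
  apply: (@steps_comp _ _ _ _ _ (State ((kept r' ++ removed r') ++ S2) E X)).
    apply/steps_ae/(@ae_trans _ _ _ _ (State (S1 ++ S2) E X)).
      by apply: perm_ae; rewrite -eS12.
    by apply: Fae => N w NCT; rewrite !holds_cat => -[_ []].
  rewrite -catA; apply: steps_rule.
  - by apply: variant_rename; apply: variant_id.
  - by apply/fdisjointP => y /fresh.
  - apply/fdisjointP => y /fresh; apply: contra.
    rewrite in_fsetU store_fv_cat in_fsetU => /orP[yS|/orP[/Fv|yE]].
    + by apply: gsV; rewrite goal_fv_cat in_fsetU yS orbT.
    + rewrite in_fsetU => /orP[yS|]; first by apply: gsV; rewrite goal_fv_cat in_fsetU yS.
      by rewrite goal_fv_cat -/(head_fv r') [y \in X]in_fsetU => ->; rewrite orbT.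
    + by apply/VX/sV; rewrite in_fsetU yE orbT.
have [||t' [rho' [s't' t'X tt']]] := sim s' ren_id.
- by move=> x /ZV/VX.
- split=> //=.
  + by rewrite -[LHS]gsubst_Var; apply: gsubst_agree.
  + by move=> N w NCT; rewrite !holds_cat => -[_ [_]].
  + by move=> x /XV/VX.
  + by move=> x /sV/VX.
  + by move=> x _; left.
(* The derivation from [t1] to [q] may be long, but the induction is on the ground success, with
   state and target arbitrary, and that of [t1] is one step shorter. *)
have [q [t1q t'q]] := confl s't1 s't'.
have [] := succeeds_expansion t'q (IH t1 q v' _ t1q _).
- by rewrite /= catA map_cat eBK eS2.
- rewrite /= !holds_cat; split=> //; split=> //; split=> //.
  exact: holds_agree (agree_sym v'E) hs.
(* [t'] is an instance of [t] through [rho'], so [w] is pulled back along it. On the globals of [t]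
   the renaming is the identity and [w] agrees with [v'], hence with [v]. *)
move=> w [wX hw sw]; exists (w \o rho'); split.
- move=> x xt /=; have xX := tV x xt.
  by rewrite (refines_id tt') // wX ?v'v // t'X; apply: VX.
- exact: (refines_store tt' MCT hw).
- by move: sw; rewrite (refines_goal tt') geval_rename.
Qed.

(** The symbolic state has only the head variables as globals, so both the locals of the rule and
    the variables representing [G] may get new values. Hence some other context [G'], which also
    absorbs the kept heads; truth of an atom asks for no particular context. *)
Lemma ground_success_rule r v G :
  List.In r P -> holds v (guard r) ->
  ground_success (map (aeval v) (kept r ++ removed r) ++ G) ->
  exists v' G', [/\ agree (head_fv r) v' v, holds v' (guard r), holds v' (body_builtin r) &
    ground_success (map (aeval v') (body_chr r) ++ G')].
Proof.
move=> Pr hG sG; have [S [v1 [v1S v1v SV]]] := represent_atoms v G (rule_vars r).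
pose s := State (kept r ++ removed r ++ S) (guard r ++ [::]) (head_fv r).
have sub_head : agree (head_fv r) v1 v by apply: (agree_sub _ v1v) => x xr; rewrite in_fsetU xr.
have st : s ->> State (body_chr r ++ kept r ++ S) (body_builtin r ++ guard r ++ [::]) (head_fv r).
  apply: steps_rule; first exact: variant_id.
    by apply/fdisjointP => x /fsetDP[].
  apply/fdisjointP => x xr; rewrite in_fsetU inE orbF; apply/negP => /SV.
  by rewrite local_vars_sub.
have [] := succeeds_reduction (v := v1) st.
- rewrite /= cats0; apply: holds_agree hG; apply/agree_sym/(agree_sub _ v1v) => x xG.
  by rewrite !in_fsetU xG !orbT.
- rewrite /= catA map_cat v1S (@geval_agree _ _ v1 v) // goal_fv_cat.
  exact: sub_head.
move=> v2 [/= v2v]; rewrite cats0 => /holds_cat[hC hG2]; rewrite map_cat => sB.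
exists v2, (map (aeval v2) (kept r ++ S)); split=> //.
by move=> x xr; rewrite v2v ?sub_head.
Qed.

(** The kept heads survive the rule step and still have to be rewritten away; the context [G'],
    supplied by the truth of the kept part of the reading, does this. *)
Lemma ground_success_unrule r v v' G G' :
  List.In r P -> agree (head_fv r) v' v -> holds v' (guard r) ->
  holds v' (body_builtin r) -> ground_success (map (aeval v') (body_chr r) ++ G) ->
  ground_success (map (aeval v) (kept r) ++ G') ->
  ground_success (map (aeval v) (kept r ++ removed r) ++ (G ++ G')).
Proof.
move=> Pr v'v hG hC sB sK.
have [/geval_agree eK /geval_agree eH] := proj1 (agreeU _ _ _ _) v'v.
apply: (ground_rule (G' := G ++ G') Pr hG hC).
  by rewrite !map_cat eK eH; apply: Permutation_refl.
apply: ground_success_perm (ground_success_cat sB sK).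
rewrite map_cat eK -!catA; apply: Permutation_app_head; rewrite !catA.
exact/Permutation_app_tail/Permutation_app_comm.
Qed.

(** * The expansion of [M] is a model of the rule readings *)

Definition success_model : structure Sg :=
  with_cint (fun d => exists G, ground_success (d :: G)).

(** Contexts of single atoms are united by [ground_success_cat]; conversely the rest of a common
    multiset serves as the context of each atom. *)
Lemma success_model_goal v S :
  @sat _ success_model v (gconj S) <->
  exists G, ground_success (map (aeval v) S ++ G).
Proof.
elim: S => [|a S IH]; first by split=> // _; exists [::]; apply: ground_nil.
have -> : @sat _ success_model v (gconj (a :: S)) <->
    (exists G, ground_success (aeval v a :: G)) /\
    (exists G, ground_success (map (aeval v) S ++ G)).
  by rewrite -IH -(sat_with_cint_FChr (fun d => exists G, ground_success (d :: G))).
split=> [[[G sa] [G' sS]]|[G sG]].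
  exists (G ++ G'); apply: ground_success_perm (ground_success_cat sa sS).
  rewrite /=; apply: perm_skip; rewrite !catA; apply: Permutation_app_tail.
  exact: Permutation_app_comm.
split; first by exists (map (aeval v) S ++ G).
exists (aeval v a :: G); apply: ground_success_perm sG.
exact: Permutation_middle.
Qed.

Lemma success_model_holds v E : @sat _ success_model v (bconj E) <-> holds v E.
Proof. exact/sat_with_cint/builtin_bconj. Qed.

Lemma success_model_theory :
  (forall A, CT A -> builtin A) -> model (program_theory CT P) success_model.
Proof.
move=> bCT A [CTA v|[r [Pr ->]]].
  by apply/sat_with_cint; [apply: bCT|apply: MCT].
apply: sat_all_closure => v [/success_model_goal[G sK] /success_model_holds hG]; split.
  move=> /success_model_goal[G' sH].
  have [|v' [G'' [v'v hG' hC' sB]]] := @ground_success_rule r v (G ++ G') Pr hG.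
    rewrite map_cat; apply: ground_success_perm (ground_success_cat sK sH).
    rewrite -!catA; apply: Permutation_app_head; rewrite !catA.
    exact/Permutation_app_tail/Permutation_app_comm.
  apply/sat_ex_except; exists v'; split=> //; split; first exact/success_model_holds.
  by split; [apply/success_model_holds|apply/success_model_goal; exists G''].
move=> /sat_ex_except[v' [v'v [/success_model_holds hG' [/success_model_holds hC']]]].
move=> /success_model_goal[G' sB]; apply/success_model_goal.
exists (map (@aeval _ M v) (kept r) ++ (G' ++ G)).
apply: ground_success_perm (ground_success_unrule Pr v'v hG' hC' sB sK).
rewrite map_cat !catA; do 2!apply: Permutation_app_tail.
exact: Permutation_app_comm.
Qed.

End Success.

(** * Soundness of transitions *)

Section Soundness.
Variables (Sg : signature) (L : constraint_language Sg).
Variables (CT : set (formula Sg)) (P : program L) (M : structure Sg).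
Implicit Types (S : seq (atom Sg)) (v w u : var -> dom M).
Notation state := (state L).
Hypothesis MCP : model (program_theory CT P) M.

Lemma gconj_cat v S S' : sat v (gconj (S ++ S')) <-> sat v (gconj S) /\ sat v (gconj S').
Proof. by rewrite /gconj map_cat sat_conj. Qed.

Lemma gconj_geval v w S S' : map (aeval v) S = map (aeval w) S' ->
  sat v (gconj S) -> sat w (gconj S').
Proof.
elim: S S' => [|a S IH] [|b S'] //= [ab SS'] [sa sS]; split; last exact: IH sS.
by have := sat_FChr w b; rewrite /= -ab => ->; have := sat_FChr v a => /= <-.
Qed.

Lemma gconj_perm v S S' : Permutation S S' -> sat v (gconj S) -> sat v (gconj S').
Proof.
elim=> {S S'} //= [a S S' _ IH [sa /IH sS]|a b S [sb [sa sS]]|S S1 S' _ IH1 _ IH2 /IH1/IH2] //.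
Qed.

(** The globals are existential as well, since only satisfiability is followed along derivations. *)
Definition satisfied (s : state) : Prop :=
  exists v, sat v (gconj (goal s)) /\ holds v (store s).

Lemma satisfied_astep s t : astep CT s t -> satisfied s <-> satisfied t.
Proof.
have MCT : model CT M by move=> A CTA; apply: MCP; left.
case=> {s t}.
- move=> S S' E X SS'; split=> -[v [sS hE]]; exists v; split=> //.
    exact: gconj_perm sS.
  by apply: gconj_perm sS; apply: Permutation_sym.
- move=> S Y t E X.
  by split=> -[v [sS hE]]; exists v; split=> //; apply: gconj_geval sS;
    have /holds_ceq[Yt _] := hE; rewrite /= geval_subst1.
- by move=> S S' X; split=> -[v [_ []]].
- move=> S E F X EF.
  have tr E1 E2 : (forall v, holds v E1 -> exists v', agree (goal_fv S `|` X) v' v /\ holds v' E2) ->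
      satisfied (State S E1 X) -> satisfied (State S E2 X).
    move=> E12 [v [sS /E12[v' [/agreeU[v'S _] hE2]]]]; exists v'; split=> //.
    by apply: gconj_geval sS; apply/esym/geval_agree.
  split; apply: tr => v; apply: ae_store_inv MCT => // N NCT u.
  by have [] := EF N NCT u.
- by move=> S E X Y _.
Qed.

Lemma satisfied_aequiv s t : aequiv CT s t -> satisfied s <-> satisfied t.
Proof.
elim=> {s t} [s t /satisfied_astep //|s //|s t _ ->//|s t u _ -> _ -> //].
Qed.

Lemma sat_closure_inst v (A : formula Sg) : sat v (all_closure A) -> sat v A.
Proof.
rewrite /all_closure; elim: (enum_fset _) => //= x Z IH /(_ (v x)) sA; apply: IH.
rewrite (_ : v = update v x (v x)) //; apply: functional_extensionality_dep => y.
by rewrite /update; case: eqP => // ->.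
Qed.

Lemma satisfied_steps s t : steps (aequiv CT) P s t -> satisfied s -> satisfied t.
Proof.
have tr s' t' : trans (aequiv CT) P s' t' -> satisfied s' -> satisfied t'.
  elim=> {s' t'} [r' D E X [r [rho [Pr er]]] _ rDE|s1 s2 s3 s4 s12 _ s23 s34]; last first.
    by move=> /(satisfied_aequiv s12)/s23/(satisfied_aequiv s34).
  move=> [v [/= /gconj_cat[sK /gconj_cat[sH sD]] /holds_cat[hG hE]]].
  have ren w S : sat w (gconj (map (arename rho) S)) <-> sat (w \o rho) (gconj S).
    by split; apply: gconj_geval; rewrite geval_rename.
  have read : sat (v \o rho) (rule_reading r) by apply: MCP; right; exists r.
  move: sK sH hG; rewrite er => /ren sK /ren sH /holds_rename hG.
  have [/(_ sH)/sat_ex_except[u [uv [hG' [hC' sB]]]] _] := sat_closure_inst read (Logic.conj sK hG).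
  (* The reading provides new values [u] for the local variables. The variant is renamed apart from
     [D] and [E], so these values can be adopted without disturbing the rest of the state. *)
  have [|//|v' [v'v v'u]] := @glue_valuation _ rho rho (head_fv r) (rule_vars r)
      (goal_fv D `|` store_fv E) v u _ _ uv => //.
    move=> x /rule_vars_split[-> //|xl _].
    by have /fdisjointP := rDE; apply; rewrite er local_vars_rename.
  have [v'D v'E] := proj1 (agreeU _ _ _ _) v'v.
  have {}v'u A : {subset A <= rule_vars r} -> agree A (v' \o rho) u.
    by move=> Ar; apply: (agree_sub _ v'u) => x /Ar xr; rewrite in_fsetU xr.
  exists v'; split=> /=.
    apply/gconj_cat; split; last apply/gconj_cat; last split.
    - apply/ren; apply: gconj_geval sB; apply/geval_agree/agree_sym/v'u => x xB.
      by rewrite !in_fsetU xB !orbT.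
    - apply/ren; apply: gconj_geval sK; apply/geval_agree => x xK.
      have xh : x \in head_fv r by rewrite in_fsetU xK.
      rewrite -uv //; apply/esym; apply: (v'u (head_fv r)) xh => y yh.
      by rewrite in_fsetU yh.
    - by apply: gconj_geval sD; apply/geval_agree/agree_sym.
  apply/holds_cat; split; last apply/holds_cat; last split.
  - apply/holds_rename; apply: holds_agree hC'; apply/agree_sym/v'u => x xC.
    by rewrite !in_fsetU xC !orbT.
  - apply/holds_rename; apply: holds_agree hG'; apply/agree_sym/v'u => x xG.
    by rewrite !in_fsetU xG !orbT.
  - exact: holds_agree (agree_sym v'E) hE.
elim=> {s t} [s t [/tr //|/satisfied_aequiv[] //]|s t u _ st _ tu /st/tu //].
Qed.

End Soundness.

(** * Membership in the inductive semantics and reachability of a non-failed answer *)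

Section Inductive.
Variables (Sg : signature) (L : constraint_language Sg).
Variables (CT : set (formula Sg)) (P : program L).
Notation state := (state L).
Notation "s ~= s'" := (aequiv CT s s') (at level 70).
Notation "s ->> s'" := (steps (aequiv CT) P s s') (at level 70).

(** Only [ae_false] can change the number of CHR constraints, and it relates failed states. So a
    state equivalent to a non-failed answer is an answer. *)
Lemma aequiv_size (s t : state) :
  s ~= t -> size (goal s) = size (goal t) \/ s ~= failed L.
Proof.
elim=> {s t} [s t|s|s t st [est|sf]|s t u st IHs tu IHt].
- case=> [S S' E X /Permutation_length SS'|S Y w E X|S S' X|S E F X _|S E X Y _].
  + by left.
  + by left; rewrite /= size_map.
  + by right; apply: ae_inconsistent => M v _ [].
  + by left.
  + by left.
- by left.
- by left.
- by right; apply: ae_trans sf; apply: ae_sym.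
case: IHs => [->|sf]; last by right.
by case: IHt => [->|tf]; [left | right; apply: ae_trans tf].
Qed.

Lemma inductive_semantics_aequiv (s t : state) :
  s ~= t -> inductive_semantics CT P t -> inductive_semantics CT P s.
Proof.
move=> st; rewrite -[inductive_semantics CT P]inductive_semantics_fixpoint => -[[u Pu tu]|[at_ tf]].
  by left; exists u => //; apply: trans_equiv st tu (ae_refl CT u).
right; split; last by move=> sf; apply: tf; apply: ae_trans sf; apply: ae_sym.
have [|sf] := aequiv_size st.
  by rewrite at_ /answers /=; case: (goal s).
by case: tf; apply: ae_trans sf; apply: ae_sym.
Qed.

Lemma inductive_semantics_steps (s t : state) :
  s ->> t -> inductive_semantics CT P t -> inductive_semantics CT P s.
Proof.
elim=> {s t} [s t [st Pt|/inductive_semantics_aequiv //]|s t u _ st _ tu /tu/st //].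
by rewrite -[inductive_semantics CT P]inductive_semantics_fixpoint; left; exists t.
Qed.

Lemma inductive_semantics_answer (s : state) : inductive_semantics CT P s ->
  exists t, [/\ s ->> t, goal t = [::] & ~ t ~= failed L].
Proof.
(* Least fixpoint induction: the states that reach a non-failed answer form a set closed under the
   operator. *)
move=> /(_ (fun s => exists t, [/\ s ->> t, goal t = [::] & ~ t ~= failed L])); apply.
move=> {}s [[t [u [tu gu uf]] st]|[gs sf]].
  by exists u; split=> //; apply: steps_comp tu; apply: t_step; left.
by exists s; split=> //; apply: steps_refl.
Qed.

End Inductive.

Theorem theorem1 (Sg : signature) (L : constraint_language Sg)
    (CT : set (formula Sg)) (P : program L)
    (D : seq (atom Sg)) (E : seq (constraint L)) (X : {fset var}) :
  (forall A, CT A -> coherent L A) ->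
  confluent (aequiv CT) P ->
  (exists s', answers L s' /\ steps (aequiv CT) P (State D E X) s') ->
  (inductive_semantics CT P (State D E X) <->
   satisfiable (program_theory CT P)
     (ex_closure (FAnd (gconj D) (bconj E)))).
Proof.
move=> coh confl [a [ans sa]]; split.
  move=> /inductive_semantics_answer[t [st gt tf]].
  have [M [v [MCT hv]]] : exists (M : structure Sg) (v : var -> dom M),
      model CT M /\ holds v (store t).
    (* If no model of [CT] satisfied the store, the answer would be equivalent to the failed
       state. *)
    apply: contrapT => no; apply: tf; case: t gt {st} no => S F Y /= -> no.
    by apply: ae_inconsistent => M v MCT hv; apply: no; exists M, v.
  have [|w [_ hw sw]] := succeeds_expansion MCT st (w := v).
    by exists v; rewrite gt; split=> //; apply: ground_nil.
  exists (success_model P M); split.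
    by apply: success_model_theory => // A /coh/coherent_builtin.
  exists w; apply/sat_ex_closure; exists w; split; last exact/success_model_holds.
  by apply/success_model_goal; exists [::]; rewrite cats0.
move=> [M [MCP [v /sat_ex_closure[w [sD hE]]]]].
(* The answer given by the hypothesis is satisfied in [M], whereas the failed state is not; so it is
   a non-failed answer, and membership travels back along [sa]. *)
have /(satisfied_steps MCP sa) sat_a : satisfied M (State D E X) by exists w.
apply: (inductive_semantics_steps sa).
rewrite -[inductive_semantics CT P]inductive_semantics_fixpoint; right; split=> //.
by move=> /(satisfied_aequiv MCP)[/(_ sat_a)[u [_ []]]].
Qed.
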